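(* Let $\alpha\ge 0$, $\beta\ge 0$, $\lambda\ge 0$, $\mu\ge 0$ be real numbers with $\lambda+\mu\ge 1$, let $0\le\gamma<1$, and let $\{a_k\}_{k=1}^{\infty}$ be a sequence of positive real numbers with $a_1=1$ satisfying: (1) $(2-\gamma)a_2\le(1-\gamma)a_1$; (2) $(3-\gamma)a_3\le\frac{1}{(2+\alpha)^{\lambda}(2+\beta)^{\mu}}(2-\gamma)a_2$; (3) $(k+2-\gamma)a_{k+2}\le\left(1+\frac{1}{k+\alpha}\right)^{-\lambda}\left(1+\frac{1}{k+\beta}\right)^{-\mu}(k+1-\gamma)a_{k+1}$ for all integers $k\ge 2$. Then for every $n\in\mathbb{N}$ the polynomial $f_n(z)=z+\sum_{k=2}^{n}a_kz^k$ is starlike of order $\gamma$ in $\mathbb{D}$, and the function $f(z)=\lim_{n\to\infty}f_n(z)=z+\sum_{k=2}^{\infty}a_kz^k$ is starlike of order $\gamma$ in $\mathbb{D}$.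
   Context: $\mathbb{D}=\{z\in\mathbb{C}:|z|<1\}$. $\mathcal{A}_0$ is the class of analytic functions $f$ on $\mathbb{D}$ with $f(0)=0$ and $f'(0)=1$. For $0\le\gamma<1$, a function $f\in\mathcal{A}_0$ is starlike of order $\gamma$ (written $f\in\mathcal{S}^{\ast}(\gamma)$) if $\mathrm{Re}\left(\frac{zf'(z)}{f(z)}\right)>\gamma$ for all $z\in\mathbb{D}$ (with the value $1$ of the quotient at $z=0$). An empty sum is zero. *)

(* Defs.v *)
From Stdlib Require Import Reals.
From Coquelicot Require Import Coquelicot.
Open Scope R_scope.

Definition unit_disk (z : C) : Prop := Cmod z < 1.

(* Analytic in the sense of complex function theory: complex differentiable at
   every point of the open disk.  The scalar field is fixed explicitly, since C
   is also a real normed module. *)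
Definition analytic_on_disk (f : C -> C) : Prop :=
  forall z : C, unit_disk z -> @ex_derive C_AbsRing C_NormedModule f z.

(* [C_derive] is a total operator; it is the complex derivative where [f] is
   complex differentiable ([C_derive_correct]), in particular here at 0. *)
Definition class_A0 (f : C -> C) : Prop :=
  analytic_on_disk f /\ f (RtoC 0) = RtoC 0 /\ C_derive f (RtoC 0) = RtoC 1.

Definition starlike_quotient (f : C -> C) (z : C) : C :=
  if Ceq_dec z (RtoC 0) then RtoC 1 else (z * C_derive f z / f z)%C.

(* Division is total in [C], so the requirement that the quotient be defined
   on the punctured disk is stated separately. *)
Definition starlike (gamma : R) (f : C -> C) : Prop :=
  class_A0 f /\
  forall z : C, unit_disk z ->
    (z <> RtoC 0 -> f z <> RtoC 0) /\ Re (starlike_quotient f z) > gamma.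

(* [sum_n_m u 2 n] is zero when n < 2. *)
Definition fpoly (a : nat -> R) (n : nat) (z : C) : C :=
  (z + sum_n_m (fun k : nat => RtoC (a k) * z ^ k) 2 n)%C.

(* Main.v *)
Require Import Defs.
From Stdlib Require Import Reals Lra Lia Arith.
From Coquelicot Require Import Coquelicot.
Open Scope R_scope.

(** Write F = f/z = sum of a_(k+1) z^k and G = f' - gamma F = sum of d_k z^k,
    where d_k = (k+1-gamma) a_(k+1).  Since z f'/f = gamma + G/F, the function f
    is starlike of order gamma as soon as Re (G/F) > 0, that is, as soon as
    Re G * Re F + Im G * Im F > 0.  It therefore suffices that F and G both have
    positive real part and that, at each z, both imaginary parts have, weakly,
    the sign of Im z.

    For z = r exp(it) these are statements about cosine and sine sums with
    coefficients d_k r^k, or a_(k+1) r^k.  Let p = lambda/(lambda+mu) and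
    q = mu/(lambda+mu); the last two hypotheses on a imply that d_k/e_k is
    nonincreasing for k >= 1, where e_1 = 1 and
    e_k = (k+alpha)^(-p) (k+beta)^(-q) for k >= 2.  Multiplying d_k by one of
    the nonincreasing weights 1/(k+1-gamma), r^k, or the indicator of k < n keeps
    this property ([dominated_mul]), so F, G and their truncations, hence the
    polynomials and the limit function, are covered at once.  Summation by parts
    ([dominated_sum_ge]) then reduces everything to the sequence e itself:
      1 + sum_(k<=n) e_k cos(kt) >= 0   and   sum_(k<=n) e_k sin(kt) >= 0
    for t in [0,pi] ([cos_sum_ge], [sin_sum_nonneg]).  For e_k = 1/k these are the
    inequalities of Young and of Fejer-Jackson.  Besides positivity, four
    features of e are enough ([envelope]): e_1 = 1, e decreases, k e_k <= 1, and
    k e_k increases for k >= 2.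

    For most t the two inequalities follow by summation by parts from k = 2,
    because e_2 <= 1/2: what is left is (1-s)(4s^2+4s-1) >= 0, with s = sin(t/2)
    for cosines and s = cos(t/2) for sines.  This leaves t close to 0 for
    cosines, where the terms with kt <= 3/2 are nonnegative and the others
    contribute little, and t close to pi for sines.  With t = pi - x the latter
    inequality reads
      sum_(2<=k<=n) (-1)^k e_k sin(kx) <= sin x.
    Pairing consecutive terms and using that k e_k increases, one sees that the
    part with kx <= 3 is largest for e_k = 1/k ([alt_sin_sum_le_harmonic]); this
    extremal sum is estimated explicitly ([alt_harmonic_sum_half]), and the rest
    of the sum again by summation by parts ([alt_sin_sum_le]).

    Holomorphy of the limit function, and the identification of f' with the
    termwise derivative, follow from a quadratic bound on the Taylor remainder
    ([power_series_derive]). *)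

(** * Summation by parts and closed forms of trigonometric sums *)

Lemma sum_n_m_R_Sm (u : nat -> R) (p q : nat) :
  (p <= S q)%nat -> sum_n_m u p (S q) = sum_n_m u p q + u (S q).
Proof. exact (sum_n_Sm u p q). Qed.

(** Abel's inequality.  The constant B absorbs a missing first term or a bound on
    oscillating partial sums; with decreasing weights it costs at most x_p B. *)
Lemma abel_lower_bound (x v : nat -> R) (B : R) (p n : nat) :
  (p <= n)%nat ->
  (forall k, (p <= k <= n)%nat -> 0 <= x k) ->
  (forall k, (p <= k < n)%nat -> x (S k) <= x k) ->
  (forall q, (p <= q <= n)%nat -> - B <= sum_n_m v p q) ->
  - (x p * B) <= sum_n_m (fun k => x k * v k) p n.
Proof.
  intros Hpn Hx0 Hx Hv.
  enough (H : forall m, (p + m <= n)%nat ->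
    x (p + m)%nat * (sum_n_m v p (p + m) + B) - x p * B
      <= sum_n_m (fun k => x k * v k) p (p + m)).
  { specialize (H (n - p)%nat ltac:(lia)).
    replace (p + (n - p))%nat with n in H by lia.
    pose proof (Hx0 n ltac:(lia)). pose proof (Hv n ltac:(lia)). nra. }
  induction m as [|m IH]; intros Hm.
  - rewrite Nat.add_0_r, !sum_n_n. lra.
  - rewrite Nat.add_succ_r, !sum_n_m_R_Sm by lia.
    specialize (IH ltac:(lia)).
    pose proof (Hx (p + m)%nat ltac:(lia)).
    pose proof (Hv (p + m)%nat ltac:(lia)). nra.
Qed.

Lemma cos_sum_telescope (t : R) (p q : nat) :
  (p <= q)%nat ->
  2 * sin (t / 2) * sum_n_m (fun k => cos (INR k * t)) p q
  = sin ((INR q + / 2) * t) - sin ((INR p - / 2) * t).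
Proof.
  assert (E : forall k, 2 * sin (t / 2) * cos (INR k * t)
      = sin ((INR k + / 2) * t) - sin ((INR k - / 2) * t)).
  { intros k.
    replace ((INR k + / 2) * t) with (INR k * t + t / 2) by field.
    replace ((INR k - / 2) * t) with (INR k * t - t / 2) by field.
    rewrite sin_plus, sin_minus. ring. }
  intros H. induction H as [|q H IH].
  - rewrite sum_n_n. apply E.
  - rewrite sum_n_m_R_Sm by lia. rewrite Rmult_plus_distr_l, IH, E, S_INR.
    replace (INR q + 1 - / 2) with (INR q + / 2) by field. ring.
Qed.

Lemma sin_sum_telescope (t : R) (p q : nat) :
  (p <= q)%nat ->
  2 * sin (t / 2) * sum_n_m (fun k => sin (INR k * t)) p q
  = cos ((INR p - / 2) * t) - cos ((INR q + / 2) * t).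
Proof.
  assert (E : forall k, 2 * sin (t / 2) * sin (INR k * t)
      = cos ((INR k - / 2) * t) - cos ((INR k + / 2) * t)).
  { intros k.
    replace ((INR k + / 2) * t) with (INR k * t + t / 2) by field.
    replace ((INR k - / 2) * t) with (INR k * t - t / 2) by field.
    rewrite cos_plus, cos_minus. ring. }
  intros H. induction H as [|q H IH].
  - rewrite sum_n_n. apply E.
  - rewrite sum_n_m_R_Sm by lia. rewrite Rmult_plus_distr_l, IH, E, S_INR.
    replace (INR q + 1 - / 2) with (INR q + / 2) by field. ring.
Qed.

Lemma alt_sin_sum_telescope (t : R) (p q : nat) :
  (p <= q)%nat ->
  2 * cos (t / 2) * sum_n_m (fun k => (-1) ^ k * sin (INR k * t)) p q
  = (-1) ^ p * sin ((INR p - / 2) * t) + (-1) ^ q * sin ((INR q + / 2) * t).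
Proof.
  assert (E : forall k, 2 * cos (t / 2) * sin (INR k * t)
      = sin ((INR k - / 2) * t) + sin ((INR k + / 2) * t)).
  { intros k.
    replace ((INR k + / 2) * t) with (INR k * t + t / 2) by field.
    replace ((INR k - / 2) * t) with (INR k * t - t / 2) by field.
    rewrite sin_plus, sin_minus. ring. }
  intros H. induction H as [|q H IH].
  - rewrite sum_n_n. rewrite <- Rmult_plus_distr_l, <- E. ring.
  - rewrite sum_n_m_R_Sm by lia. rewrite Rmult_plus_distr_l, IH, S_INR.
    rewrite <- (Rmult_assoc _ ((-1) ^ S q)).
    rewrite (Rmult_comm _ ((-1) ^ S q)), Rmult_assoc, <- S_INR, E, S_INR.
    replace (INR q + 1 - / 2) with (INR q + / 2) by field. simpl. ring.
Qed.

Lemma sin_lower_cubic (x : R) : 0 <= x <= 1 -> x - x ^ 3 / 6 <= sin x.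
Proof.
  intros Hx. pose proof PI2_3_2 as HPI.
  destruct (SIN x) as [H _]; try lra.
  unfold sin_lb, sin_approx, sin_term in H. simpl in H.
  assert (0 <= x ^ 5 * (42 - x ^ 2)) by
    (apply Rmult_le_pos; [apply pow_le; lra | nra]).
  simpl in *. lra.
Qed.

Lemma cos_lower_quadratic (x : R) : 1 - x ^ 2 / 2 <= cos x.
Proof.
  replace x with (2 * (x / 2)) at 2 by field. rewrite cos_2a_sin.
  enough (sin (x / 2) * sin (x / 2) <= (x / 2) * (x / 2)) by nra.
  apply Rsqr_le_abs_1.
  destruct (Rle_dec 0 (x / 2)) as [H|H].
  - rewrite (Rabs_pos_eq _ H).
    destruct (Rle_dec 1 (x / 2)).
    + pose proof (SIN_bound (x / 2)). apply Rabs_le. lra.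
    + pose proof PI2_3_2. rewrite Rabs_pos_eq.
      * destruct H as [H| <-]; [left; now apply sin_lt_x | rewrite sin_0; lra].
      * apply sin_ge_0; lra.
  - rewrite <- (Rabs_Ropp (sin _)), <- (Rabs_Ropp (x / 2)), <- sin_neg.
    assert (0 < - (x / 2)) by lra. rewrite (Rabs_pos_eq (- (x / 2))) by lra.
    destruct (Rle_dec 1 (- (x / 2))).
    + pose proof (SIN_bound (- (x / 2))). apply Rabs_le. lra.
    + pose proof PI2_3_2. rewrite Rabs_pos_eq.
      * left; now apply sin_lt_x.
      * apply sin_ge_0; lra.
Qed.

(** sin u / u is nonincreasing on (0,pi], written without quotients: by the mean
    value theorem the chord slope over [x,y] is at most the one over [0,x]. *)
Lemma sin_chord_le (x y : R) : 0 < x <= y -> y <= PI -> x * sin y <= y * sin x.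
Proof.
  intros [Hx [Hxy| ->]] Hy; [|lra].
  destruct (MVT_cor2 sin cos x y Hxy) as [c [Hc Hc']].
  { intros; apply derivable_pt_lim_sin. }
  destruct (MVT_cor2 sin cos 0 x Hx) as [c' [Hd Hd']].
  { intros; apply derivable_pt_lim_sin. }
  rewrite sin_0 in Hd.
  assert (cos c <= cos c') by (left; apply cos_decreasing_1; lra).
  assert (x * (cos c * (y - x)) <= x * (cos c' * (y - x))).
  { apply Rmult_le_compat_l; [lra|]. apply Rmult_le_compat_r; lra. }
  nra.
Qed.

(** * Cosine sums *)

(** The features of (k+alpha)^(-p) (k+beta)^(-q), p + q = 1, and of 1/k, on which
    the trigonometric inequalities rest.  The term at 1 is normalised separately,
    so that k e_k increases only from k = 2 on: it starts at 1, may drop, and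
    then climbs back to at most 1. *)
Record envelope (e : nat -> R) : Prop := Envelope {
  env_one : e 1%nat = 1;
  env_pos : forall k, (1 <= k)%nat -> 0 < e k;
  env_decr : forall k, (1 <= k)%nat -> e (S k) <= e k;
  env_le_inv : forall k, (1 <= k)%nat -> INR k * e k <= 1;
  env_mul_incr : forall k, (2 <= k)%nat -> INR k * e k <= INR (S k) * e (S k)
}.

Lemma sum_n_m_R_head (u : nat -> R) (n : nat) :
  (2 <= n)%nat -> sum_n_m u 1 n = u 1%nat + sum_n_m u 2 n.
Proof. intros H. rewrite sum_Sn_m by lia. reflexivity. Qed.

Lemma sum_n_m_R_ext (u v : nat -> R) (p q : nat) :
  (forall k, u k = v k) -> sum_n_m u p q = sum_n_m v p q.
Proof. intros H. now apply sum_n_m_ext. Qed.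

Lemma sum_n_m_R_opp (u : nat -> R) (p q : nat) :
  sum_n_m (fun k => - u k) p q = - sum_n_m u p q.
Proof.
  rewrite (sum_n_m_ext (fun k => - u k) (fun k => mult (-1) (u k))).
  - etransitivity; [exact (sum_n_m_mult_l (K := R_Ring) (-1) u p q)|].
    change (-1 * sum_n_m u p q = - sum_n_m u p q). ring.
  - intros. unfold mult; simpl. ring.
Qed.

Lemma sum_n_m_R_nonneg (u : nat -> R) (p q : nat) :
  (forall k, (p <= k <= q)%nat -> 0 <= u k) -> 0 <= sum_n_m u p q.
Proof.
  intros H. induction q as [|q IH].
  - destruct p; [rewrite sum_n_n; apply H; lia|].
    rewrite sum_n_m_zero by lia. apply Rle_refl.
  - destruct (le_lt_dec p (S q)) as [L|L].
    + rewrite sum_n_m_R_Sm by lia. apply Rplus_le_le_0_compat; [|apply H; lia].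
      apply IH. intros; apply H; lia.
    + rewrite sum_n_m_zero by lia. apply Rle_refl.
Qed.

Lemma sin_half_large (t : R) : / 2 <= t <= PI -> 24 / 100 <= sin (t / 2).
Proof.
  intros H. pose proof (sin_lower_cubic (/ 4) ltac:(lra)).
  pose proof PI2_3_2.
  assert (sin (/ 4) <= sin (t / 2)) by (apply sin_incr_1; lra). lra.
Qed.

Lemma sin_three_halves (t : R) :
  sin (3 / 2 * t) = 3 * sin (t / 2) - 4 * sin (t / 2) ^ 3.
Proof.
  replace (3 / 2 * t) with (2 * (t / 2) + t / 2) by field.
  rewrite sin_plus, sin_2a, cos_2a.
  pose proof (sin2_cos2 (t / 2)) as H. unfold Rsqr in H.
  replace (cos (t / 2) * cos (t / 2)) with (1 - sin (t / 2) * sin (t / 2)) by lra.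
  transitivity (2 * sin (t / 2) * (cos (t / 2) * cos (t / 2))
    + (1 - 2 * sin (t / 2) * sin (t / 2)) * sin (t / 2)); [ring|].
  replace (cos (t / 2) * cos (t / 2)) with (1 - sin (t / 2) * sin (t / 2)) by lra.
  ring.
Qed.

Lemma cos_three_halves (t : R) :
  cos (3 / 2 * t) = 4 * cos (t / 2) ^ 3 - 3 * cos (t / 2).
Proof.
  pose proof (sin_three_halves (PI - t)) as H.
  replace ((PI - t) / 2) with (PI / 2 - t / 2) in H by field.
  rewrite sin_shift in H.
  replace (3 / 2 * (PI - t)) with (PI + (PI / 2 - 3 / 2 * t)) in H by field.
  rewrite Rplus_comm, neg_sin, sin_shift in H. lra.
Qed.

Lemma envelope_two (e : nat -> R) : envelope e -> 0 < e 2%nat <= / 2.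
Proof.
  intros He. pose proof (env_pos e He 2 ltac:(lia)).
  pose proof (env_le_inv e He 2 ltac:(lia)) as H2. simpl in H2. lra.
Qed.

Lemma envelope_tail (e v : nat -> R) (B : R) (p n : nat) :
  envelope e -> (1 <= p <= n)%nat ->
  (forall q, (p <= q <= n)%nat -> - B <= sum_n_m v p q) ->
  - (e p * B) <= sum_n_m (fun k => e k * v k) p n.
Proof.
  intros He Hp Hv. apply abel_lower_bound; try assumption; try lia.
  - intros k Hk. left. apply (env_pos e He). lia.
  - intros k Hk. apply (env_decr e He). lia.
Qed.

(** The terms from k = 2 on are at least -e_2 (1 + sin(3t/2)) / (2s), s = sin(t/2),
    and e_2 <= 1/2, so it is enough that 1 + cos t dominates a quarter of
    (1 + sin(3t/2)) / s; with sin(3t/2) = 3s - 4s^3 this is a cubic inequality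
    in s, valid for s >= (sqrt 2 - 1)/2 = 0.207... *)
Lemma cos_sum_away_from_zero (e : nat -> R) (t : R) (n : nat) :
  envelope e -> / 2 <= t <= PI -> (1 <= n)%nat ->
  - 1 <= sum_n_m (fun k => e k * cos (INR k * t)) 1 n.
Proof.
  intros He Ht Hn.
  destruct (le_lt_dec 2 n) as [H2n|H2n].
  2:{ replace n with 1%nat by lia. rewrite sum_n_n, (env_one e He).
      pose proof (COS_bound (INR 1 * t)). lra. }
  rewrite sum_n_m_R_head by assumption. rewrite (env_one e He).
  pose proof (sin_half_large t Ht) as Hs.
  pose proof (SIN_bound (t / 2)) as Hs1.
  pose proof (SIN_bound (3 / 2 * t)) as H3.
  pose proof (sin_three_halves t) as E3.
  assert (Ec : cos (INR 1 * t) = 1 - 2 * sin (t / 2) * sin (t / 2)).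
  { rewrite <- cos_2a_sin. f_equal. simpl. field. }
  set (s := sin (t / 2)) in *.
  set (B := (1 + sin (3 / 2 * t)) / (2 * s)).
  assert (HB : 2 * s * B = 1 + sin (3 / 2 * t)) by (unfold B; field; lra).
  assert (HB0 : 0 <= B).
  { unfold B. apply Rdiv_le_0_compat; lra. }
  pose proof (envelope_tail e (fun k => cos (INR k * t)) B 2 n He ltac:(lia)) as T.
  assert (T' : - (e 2%nat * B)
    <= sum_n_m (fun k => e k * cos (INR k * t)) 2 n).
  { apply T. intros q Hq.
    apply Rmult_le_reg_l with (2 * s); [lra|].
    unfold s at 2; rewrite cos_sum_telescope by lia.
    replace ((INR 2 - / 2) * t) with (3 / 2 * t) by (simpl; field).
    pose proof (SIN_bound ((INR q + / 2) * t)). lra. }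
  pose proof (envelope_two e He) as He2.
  assert (e 2%nat * B <= / 2 * B) by (apply Rmult_le_compat_r; lra).
  rewrite Ec.
  enough (/ 2 * B <= 2 - 2 * s * s) by lra.
  apply Rmult_le_reg_l with (4 * s); [lra|].
  replace (4 * s * (/ 2 * B)) with (2 * s * B) by field.
  rewrite HB, E3.
  enough (0 <= (1 - s) * (4 * s ^ 2 + 4 * s - 1)) by lra.
  apply Rmult_le_pos; nra.
Qed.

(** Let N be the last index with N t <= 3/2.  Up to N the cosines are nonnegative,
    and beyond N summation by parts loses at most e_(N+1)/sin(t/2), where
    e_(N+1) <= 1/(N+1) < 2t/3: about 4/3, less than 1 + cos t. *)
Lemma cos_sum_near_zero (e : nat -> R) (t : R) (n : nat) :
  envelope e -> 0 < t <= / 2 -> (1 <= n)%nat ->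
  - 1 <= sum_n_m (fun k => e k * cos (INR k * t)) 1 n.
Proof.
  intros He Ht Hn.
  destruct (nfloor_ex (3 / 2 / t)) as [N [HN1 HN2]].
  { apply Rdiv_le_0_compat; lra. }
  assert (HN1' : INR N * t <= 3 / 2).
  { apply Rmult_le_reg_r with (/ t); [apply Rinv_0_lt_compat; lra|].
    replace (INR N * t * / t) with (INR N) by (field; lra). exact HN1. }
  assert (HN2' : 3 / 2 < (INR N + 1) * t).
  { apply Rmult_lt_reg_r with (/ t); [apply Rinv_0_lt_compat; lra|].
    replace ((INR N + 1) * t * / t) with (INR N + 1) by (field; lra). exact HN2. }
  assert (HN : (2 <= N)%nat).
  { apply INR_le. simpl.
    assert (3 < INR N + 1) by nra. lra. }
  assert (Hcos : forall k, (k <= N)%nat -> 0 <= e k * cos (INR k * t) \/ k = 0%nat).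
  { intros k Hk. destruct k; [now right|left].
    apply Rmult_le_pos; [left; apply (env_pos e He); lia|].
    pose proof PI2_3_2. pose proof (le_INR _ _ Hk). pose proof (pos_INR (S k)).
    apply cos_ge_0; nra. }
  assert (Hhead : forall m, (m <= N)%nat -> (2 <= m)%nat ->
    cos t <= sum_n_m (fun k => e k * cos (INR k * t)) 1 m).
  { intros m Hm Hm2. rewrite sum_n_m_R_head by lia.
    rewrite (env_one e He). replace (INR 1 * t) with t by (simpl; ring).
    enough (0 <= sum_n_m (fun k => e k * cos (INR k * t)) 2 m) by lra.
    apply sum_n_m_R_nonneg. intros k Hk. destruct (Hcos k); [lia|lra|lia]. }
  pose proof (cos_lower_quadratic t) as Hct.
  assert (t ^ 2 <= / 4) by nra.
  destruct (le_lt_dec n N) as [HnN|HnN].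
  - destruct (le_lt_dec 2 n) as [H2|H2].
    + specialize (Hhead n HnN H2). lra.
    + replace n with 1%nat by lia. rewrite sum_n_n.
      destruct (Hcos 1%nat); [lia|lra|lia].
  - rewrite (sum_n_m_Chasles _ 1 N n) by lia. change plus with Rplus.
    specialize (Hhead N (le_n N) HN).
    pose proof (sin_lower_cubic (t / 2) ltac:(lra)) as Hs.
    assert (Hs' : 49 / 100 * t <= sin (t / 2)) by nra.
    set (s := sin (t / 2)) in *.
    assert (HB : - (e (S N) * / s)
      <= sum_n_m (fun k => e k * cos (INR k * t)) (S N) n).
    { apply envelope_tail; [assumption|lia|]. intros q Hq.
      apply Rmult_le_reg_l with (2 * s); [lra|].
      unfold s at 3; rewrite cos_sum_telescope by lia.
      replace (2 * s * - / s) with (- 2) by (field; lra).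
      pose proof (SIN_bound ((INR q + / 2) * t)).
      pose proof (SIN_bound ((INR (S N) - / 2) * t)). lra. }
    pose proof (env_le_inv e He (S N) ltac:(lia)) as Hle. rewrite S_INR in Hle.
    pose proof (env_pos e He (S N) ltac:(lia)) as Hpos.
    assert (Hep : e (S N) <= 2 / 3 * t) by nra.
    enough (e (S N) * / s <= 14 / 10) by lra.
    apply Rmult_le_reg_r with s; [lra|].
    replace (e (S N) * / s * s) with (e (S N)) by (field; lra). lra.
Qed.

Lemma cos_sum_ge (e : nat -> R) (t : R) (n : nat) :
  envelope e -> 0 <= t <= PI -> (1 <= n)%nat ->
  - 1 <= sum_n_m (fun k => e k * cos (INR k * t)) 1 n.
Proof.
  intros He Ht Hn.
  destruct (Rle_dec (/ 2) t) as [H|H].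
  { apply cos_sum_away_from_zero; [assumption|lra|assumption]. }
  destruct (Req_dec t 0) as [->|H0].
  - enough (0 <= sum_n_m (fun k => e k * cos (INR k * 0)) 1 n) by lra.
    apply sum_n_m_R_nonneg. intros k Hk. rewrite Rmult_0_r, cos_0.
    pose proof (env_pos e He k ltac:(lia)). lra.
  - apply cos_sum_near_zero; [assumption|lra|assumption].
Qed.

(** * Sine sums *)

(** As for cosines, with c = cos(t/2) in the role of s: here
    cos(3t/2) = 4c^3 - 3c, and the same cubic inequality results. *)
Lemma sin_sum_away_from_pi (e : nat -> R) (t : R) (n : nat) :
  envelope e -> 0 < t <= PI - / 2 -> (1 <= n)%nat ->
  0 <= sum_n_m (fun k => e k * sin (INR k * t)) 1 n.
Proof.
  intros He Ht Hn.
  assert (Hsin1 : 0 <= sin (INR 1 * t)).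
  { simpl; rewrite Rmult_1_l. apply sin_ge_0; lra. }
  destruct (le_lt_dec 2 n) as [H2n|H2n].
  2:{ replace n with 1%nat by lia. rewrite sum_n_n, (env_one e He). lra. }
  rewrite sum_n_m_R_head by assumption. rewrite (env_one e He).
  pose proof (sin_half_large (PI - t) ltac:(lra)) as Hc.
  replace ((PI - t) / 2) with (PI / 2 - t / 2) in Hc by field.
  rewrite sin_shift in Hc.
  pose proof (COS_bound (t / 2)) as Hc1.
  pose proof (COS_bound (3 / 2 * t)) as H3.
  pose proof (cos_three_halves t) as E3.
  assert (Es : sin (INR 1 * t) = 2 * sin (t / 2) * cos (t / 2)).
  { rewrite <- sin_2a. f_equal. simpl. field. }
  assert (Hs : 0 < sin (t / 2)) by (apply sin_gt_0; lra).
  pose proof (sin2_cos2 (t / 2)) as Hsc. unfold Rsqr in Hsc.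
  set (s := sin (t / 2)) in *. set (c := cos (t / 2)) in *.
  set (B := (1 - cos (3 / 2 * t)) / (2 * s)).
  assert (HB : 2 * s * B = 1 - cos (3 / 2 * t)) by (unfold B; field; lra).
  assert (HB0 : 0 <= B).
  { unfold B. apply Rdiv_le_0_compat; lra. }
  assert (T' : - (e 2%nat * B)
    <= sum_n_m (fun k => e k * sin (INR k * t)) 2 n).
  { apply envelope_tail; [assumption|lia|]. intros q Hq.
    apply Rmult_le_reg_l with (2 * s); [lra|].
    unfold s at 2; rewrite sin_sum_telescope by lia.
    replace ((INR 2 - / 2) * t) with (3 / 2 * t) by (simpl; field).
    pose proof (COS_bound ((INR q + / 2) * t)). lra. }
  pose proof (envelope_two e He) as He2.
  assert (e 2%nat * B <= / 2 * B) by (apply Rmult_le_compat_r; lra).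
  rewrite Es.
  enough (/ 2 * B <= 2 * s * c) by lra.
  apply Rmult_le_reg_l with (4 * s); [lra|].
  replace (4 * s * (/ 2 * B)) with (2 * s * B) by field.
  rewrite HB, E3.
  replace (4 * s * (2 * s * c)) with (8 * (s * s) * c) by ring.
  replace (s * s) with (1 - c * c) by lra.
  enough (0 <= (1 - c) * (4 * c ^ 2 + 4 * c - 1)) by lra.
  apply Rmult_le_pos; nra.
Qed.

(** Near pi the sine sum becomes, in x = pi - t, an alternating sum. *)
Lemma sin_mul_PI_minus (x : R) (k : nat) :
  sin (INR k * (PI - x)) = - ((-1) ^ k * sin (INR k * x)).
Proof.
  enough (H : sin (INR k * (PI - x)) = - ((-1) ^ k * sin (INR k * x))
    /\ cos (INR k * (PI - x)) = (-1) ^ k * cos (INR k * x)) by apply H.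
  induction k as [|k [IHs IHc]].
  - simpl. rewrite !Rmult_0_l, sin_0, cos_0. lra.
  - rewrite S_INR.
    replace ((INR k + 1) * (PI - x)) with (INR k * (PI - x) + (PI - x)) by ring.
    replace ((INR k + 1) * x) with (INR k * x + x) by ring.
    rewrite !sin_plus, !cos_plus, IHs, IHc.
    rewrite sin_PI_x, Rtrigo_facts.cos_pi_minus. simpl. split; ring.
Qed.

Lemma sin_div_decr (x : R) (k : nat) :
  0 < x -> (1 <= k)%nat -> INR (S k) * x <= PI ->
  sin (INR (S k) * x) / INR (S k) <= sin (INR k * x) / INR k.
Proof.
  intros Hx Hk HPI. pose proof (lt_0_INR k ltac:(lia)) as H0.
  rewrite S_INR in *.
  pose proof (sin_chord_le (INR k * x) ((INR k + 1) * x) ltac:(nra) HPI) as H.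
  apply Rmult_le_reg_r with ((INR k + 1) * INR k * x); [apply Rmult_lt_0_compat; nra|].
  replace (sin ((INR k + 1) * x) / (INR k + 1) * ((INR k + 1) * INR k * x))
    with (INR k * x * sin ((INR k + 1) * x)) by (field; lra).
  replace (sin (INR k * x) / INR k * ((INR k + 1) * INR k * x))
    with ((INR k + 1) * x * sin (INR k * x)) by (field; lra). exact H.
Qed.

Lemma pow_m1_even (m : nat) : (-1) ^ (2 * m) = 1.
Proof. rewrite pow_mult. replace ((-1) ^ 2) with 1 by ring. apply pow1. Qed.

Lemma alt_sum_pair (w : nat -> R) (m : nat) :
  sum_n_m (fun k => (-1) ^ k * w k) 2 (2 * S m + 1)
  = sum_n_m (fun k => (-1) ^ k * w k) 2 (2 * m + 1)
    + (w (2 * m + 2)%nat - w (2 * m + 3)%nat) :> R.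
Proof.
  replace (2 * S m + 1)%nat with (S (S (2 * m + 1))) by lia.
  rewrite !sum_n_m_R_Sm by lia.
  replace (S (2 * m + 1)) with (2 * S m)%nat by lia.
  replace (S (2 * S m)) with (2 * S m + 1)%nat by lia.
  rewrite pow_add, pow_m1_even.
  replace (2 * S m)%nat with (2 * m + 2)%nat by lia.
  replace (2 * m + 2 + 1)%nat with (2 * m + 3)%nat by lia. ring.
Qed.

(** With y_k = k e_k and v_k = sin(kx)/k, each pair with k even contributes
    y_k v_k - y_(k+1) v_(k+1) <= y_k (v_k - v_(k+1)) <= v_k - v_(k+1): the first
    step because y increases, the second because y <= 1 and v decreases. *)
Lemma alt_sin_sum_le_harmonic (e : nat -> R) (x : R) (m : nat) :
  envelope e -> 0 < x -> INR (2 * m + 1) * x <= PI ->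
  sum_n_m (fun k => (-1) ^ k * (e k * sin (INR k * x))) 2 (2 * m + 1)
  <= sum_n_m (fun k => (-1) ^ k * (sin (INR k * x) / INR k)) 2 (2 * m + 1).
Proof.
  intros He Hx. induction m as [|m IH]; intros HPI.
  - rewrite !sum_n_m_zero by lia. apply Rle_refl.
  - rewrite !alt_sum_pair.
    assert (HS : forall k, (k <= 2 * m + 3)%nat -> INR k * x <= PI).
    { intros k Hk. eapply Rle_trans; [|exact HPI].
      apply Rmult_le_compat_r; [lra|]. apply le_INR. lia. }
    apply Rplus_le_compat; [apply IH, HS; lia|].
    replace (2 * m + 3)%nat with (S (2 * m + 2)) by lia.
    set (k := (2 * m + 2)%nat).
    assert (Hk : (2 <= k)%nat) by (unfold k; lia).
    assert (HkPI : INR (S k) * x <= PI) by (apply HS; unfold k; lia).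
    pose proof (sin_div_decr x k Hx ltac:(lia) HkPI) as Hdec.
    pose proof (env_mul_incr e He k Hk) as Hinc.
    pose proof (env_le_inv e He k ltac:(lia)) as Hle.
    pose proof (lt_0_INR k ltac:(lia)) as Hk0.
    pose proof (lt_0_INR (S k) ltac:(lia)) as Hk1.
    assert (Hv : 0 <= sin (INR (S k) * x) / INR (S k)).
    { apply Rdiv_le_0_compat; [|assumption]. apply sin_ge_0; nra. }
    replace (e k * sin (INR k * x))
      with (INR k * e k * (sin (INR k * x) / INR k)) by (field; lra).
    replace (e (S k) * sin (INR (S k) * x))
      with (INR (S k) * e (S k) * (sin (INR (S k) * x) / INR (S k))) by (field; lra).
    pose proof (env_pos e He k ltac:(lia)).
    set (y := INR k * e k) in *. set (y' := INR (S k) * e (S k)) in *.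
    set (v := sin (INR k * x) / INR k) in *.
    set (v' := sin (INR (S k) * x) / INR (S k)) in *.
    assert (y * (v - v') <= 1 * (v - v')) by (apply Rmult_le_compat_r; lra).
    assert (y * v' <= y' * v') by (apply Rmult_le_compat_r; lra). lra.
Qed.

(** Telescoping over even k: v_k - v_(k+1) <= v_(k-1) - v_(k+1) for v_k = sin(kx)/k. *)
Lemma alt_harmonic_sum_le (x : R) (m : nat) :
  0 < x -> INR (2 * m + 1) * x <= PI ->
  sum_n_m (fun k => (-1) ^ k * (sin (INR k * x) / INR k)) 2 (2 * m + 1)
  <= sin x - sin (INR (2 * m + 1) * x) / INR (2 * m + 1).
Proof.
  intros Hx. induction m as [|m IH]; intros HPI.
  - rewrite sum_n_m_zero by lia. change (2 * 0 + 1)%nat with 1%nat.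
    change (0 <= sin x - sin (1 * x) / 1). rewrite Rmult_1_l. lra.
  - rewrite alt_sum_pair.
    assert (HS : forall k, (k <= 2 * m + 3)%nat -> INR k * x <= PI).
    { intros k Hk. eapply Rle_trans; [|exact HPI].
      apply Rmult_le_compat_r; [lra|]. apply le_INR. lia. }
    specialize (IH (HS (2 * m + 1)%nat ltac:(lia))).
    pose proof (sin_div_decr x (2 * m + 1) Hx ltac:(lia)
      (HS (S (2 * m + 1)) ltac:(lia))) as H1.
    replace (S (2 * m + 1)) with (2 * m + 2)%nat in H1 by lia.
    replace (2 * S m + 1)%nat with (2 * m + 3)%nat by lia. lra.
Qed.

Lemma alt_sin_sum_short (e : nat -> R) (x : R) (n : nat) :
  envelope e -> 0 < x -> INR n * x <= PI -> (1 <= n)%nat ->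
  sum_n_m (fun k => (-1) ^ k * (e k * sin (INR k * x))) 2 n <= sin x.
Proof.
  intros He Hx HPI Hn.
  assert (HS : forall k, (k <= n)%nat -> INR k * x <= PI).
  { intros k Hk. eapply Rle_trans; [|exact HPI].
    apply Rmult_le_compat_r; [lra|]. now apply le_INR. }
  assert (Hodd : forall m, (2 * m + 1 <= n)%nat ->
    sum_n_m (fun k => (-1) ^ k * (e k * sin (INR k * x))) 2 (2 * m + 1)
    <= sin x - sin (INR (2 * m + 1) * x) / INR (2 * m + 1)).
  { intros m Hm.
    eapply Rle_trans; [apply alt_sin_sum_le_harmonic|apply alt_harmonic_sum_le];
      auto. }
  assert (Hv : forall k, (1 <= k <= n)%nat -> 0 <= sin (INR k * x) / INR k).
  { intros k Hk. pose proof (lt_0_INR k ltac:(lia)).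
    apply Rdiv_le_0_compat; [|assumption].
    apply sin_ge_0; [nra|apply HS; lia]. }
  destruct (Nat.Even_or_Odd n) as [[m ->]|[m ->]].
  - destruct m as [|m]; [lia|].
    replace (2 * S m)%nat with (S (2 * m + 1)) in * by lia.
    rewrite sum_n_m_R_Sm by lia.
    replace (S (2 * m + 1)) with (2 * S m)%nat at 1 by lia. rewrite pow_m1_even.
    set (k := (2 * m + 1)%nat) in *.
    pose proof (Hodd m ltac:(lia)) as H1. fold k in H1.
    pose proof (sin_div_decr x k Hx ltac:(lia) HPI) as Hdec.
    pose proof (env_le_inv e He (S k) ltac:(lia)) as Hle.
    pose proof (lt_0_INR (S k) ltac:(lia)) as Hk1.
    pose proof (Hv (S k) ltac:(lia)) as Hvk.
    replace (e (S k) * sin (INR (S k) * x))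
      with (INR (S k) * e (S k) * (sin (INR (S k) * x) / INR (S k))) by (field; lra).
    nra.
  - pose proof (Hodd m (le_n _)). pose proof (Hv (2 * m + 1)%nat ltac:(lia)). lra.
Qed.

(** Multiplying by 2cos(x/2) splits sin(kx) into sines S_j = sin((j+1/2)x) at
    j = k-1 and j = k, and the sum becomes
      S_1/2 + sum_(k=2..N-1) (-1)^k S_k / (k(k+1)) - S_N/N,   N = 2m+1.
    The terms S_k/(k(k+1)) decrease, so the alternating sum is at most its first
    term S_2/6.  The end term -S_N/N is kept: it compensates for the lower end of
    the remaining part of the sine sum. *)
Lemma alt_harmonic_sum_half (x : R) (m : nat) :
  0 < x -> (1 <= m)%nat -> (INR (2 * m + 1) + / 2) * x <= PI ->
  2 * cos (x / 2)
    * sum_n_m (fun k => (-1) ^ k * (sin (INR k * x) / INR k)) 2 (2 * m + 1)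
  <= sin (3 / 2 * x) / 2 + sin (5 / 2 * x) / 6
     - sin ((INR (2 * m + 1) + / 2) * x) / INR (2 * m + 1).
Proof.
  intros Hx Hm.
  assert (E : forall k, 2 * cos (x / 2) * sin (INR (S k) * x)
      = sin ((INR k + / 2) * x) + sin ((INR (S k) + / 2) * x)).
  { intros k. rewrite S_INR.
    replace ((INR k + 1 + / 2) * x) with ((INR k + 1) * x + x / 2) by field.
    replace ((INR k + / 2) * x) with ((INR k + 1) * x - x / 2) by field.
    rewrite sin_plus, sin_minus. ring. }
  induction Hm as [|m Hm IH]; intros HPI.
  - change (2 * 1 + 1)%nat with (2 * S 0 + 1)%nat.
    rewrite alt_sum_pair, sum_n_m_zero by lia. change zero with 0.
    change (2 * 0 + 2)%nat with 2%nat. change (2 * 0 + 3)%nat with 3%nat.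
    change (2 * 1 + 1)%nat with 3%nat.
    rewrite Rplus_0_l.
    replace (2 * cos (x / 2) * (sin (INR 2 * x) / INR 2 - sin (INR 3 * x) / INR 3))
      with (2 * cos (x / 2) * sin (INR 2 * x) / 2
            - 2 * cos (x / 2) * sin (INR 3 * x) / 3) by (simpl; field).
    rewrite !E.
    replace ((INR 1 + / 2) * x) with (3 / 2 * x) by (simpl; field).
    replace ((INR 2 + / 2) * x) with (5 / 2 * x) by (simpl; field).
    replace (INR 3) with 3 by (simpl; lra). lra.
  - rewrite alt_sum_pair, Rmult_plus_distr_l.
    replace (2 * S m + 1)%nat with (2 * m + 3)%nat in * by lia.
    replace (2 * m + 3)%nat with (S (S (2 * m + 1))) in * by lia.
    replace (2 * m + 2)%nat with (S (2 * m + 1)) by lia.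
    set (k := (2 * m + 1)%nat) in *.
    rewrite !S_INR in HPI.
    pose proof (lt_0_INR k ltac:(unfold k; lia)) as Hk0.
    specialize (IH ltac:(nra)).
    replace (2 * cos (x / 2)
      * (sin (INR (S k) * x) / INR (S k) - sin (INR (S (S k)) * x) / INR (S (S k))))
      with (2 * cos (x / 2) * sin (INR (S k) * x) / INR (S k)
        - 2 * cos (x / 2) * sin (INR (S (S k)) * x) / INR (S (S k)))
      by (rewrite !S_INR; field; lra).
    rewrite !E. rewrite !S_INR in *.
    set (s0 := sin ((INR k + / 2) * x)) in *.
    set (s1 := sin ((INR k + 1 + / 2) * x)) in *.
    set (s2 := sin ((INR k + 1 + 1 + / 2) * x)) in *.
    (* S_(k+1)/((k+1)(k+2)) <= S_k/(k(k+1)): sin u / u decreases, and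
       (k+3/2)/(k+1/2) <= (k+2)/k *)
    assert (Hs0 : 0 <= s0) by (apply sin_ge_0; nra).
    assert (Hs : (INR k + / 2) * s1 <= (INR k + 1 + / 2) * s0).
    { apply Rmult_le_reg_r with x; [assumption|].
      pose proof (sin_chord_le ((INR k + / 2) * x) ((INR k + 1 + / 2) * x)
        ltac:(nra) ltac:(nra)) as H. fold s0 s1 in H. lra. }
    assert (Hd : INR k * s1 <= (INR k + 2) * s0) by nra.
    enough ((s0 + s1) / (INR k + 1) - (s1 + s2) / (INR k + 1 + 1)
      <= s0 / INR k - s2 / (INR k + 1 + 1)) by lra.
    apply Rmult_le_reg_r with (INR k * (INR k + 1) * (INR k + 1 + 1)).
    { repeat apply Rmult_lt_0_compat; lra. }
    replace (((s0 + s1) / (INR k + 1) - (s1 + s2) / (INR k + 1 + 1))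
        * (INR k * (INR k + 1) * (INR k + 1 + 1)))
      with (INR k * (s0 * (INR k + 2) + s1 - s2 * (INR k + 1))) by (field; lra).
    replace ((s0 / INR k - s2 / (INR k + 1 + 1))
        * (INR k * (INR k + 1) * (INR k + 1 + 1)))
      with (s0 * (INR k + 1) * (INR k + 2) - INR k * s2 * (INR k + 1)) by (field; lra).
    lra.
Qed.

(** If nx > 3, let N be the odd number with (N+1)x <= 3 < (N+3)x.  After multiplication by
    2cos(x/2) the terms up to N give at most S_1/2 + S_2/6 - S_N/N, in the notation
    S_j = sin((j+1/2)x), and those beyond N at most e_(N+1) (S_N + 1).  The two
    terms in S_N cancel favourably, which leaves at most
    (3/4 + 5/12 + 1/2) x = (5/3) x, while 2cos(x/2) sin x > 1.8 x for
    x <= 1/2. *)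
Lemma alt_sin_sum_le (e : nat -> R) (x : R) (n : nat) :
  envelope e -> 0 < x <= / 2 -> (1 <= n)%nat ->
  sum_n_m (fun k => (-1) ^ k * (e k * sin (INR k * x))) 2 n <= sin x.
Proof.
  intros He Hx Hn. pose proof PI2_3_2 as HPI.
  destruct (nfloor_ex (3 / x / 2)) as [M [HM1 HM2]].
  { apply Rdiv_le_0_compat; [|lra]. apply Rdiv_le_0_compat; lra. }
  assert (HM1' : 2 * INR M * x <= 3).
  { replace 3 with (3 / x / 2 * (2 * x)) by (field; lra).
    apply Rle_trans with (INR M * (2 * x)); [lra|]. apply Rmult_le_compat_r; lra. }
  assert (HM2' : 3 < 2 * (INR M + 1) * x).
  { replace 3 with (3 / x / 2 * (2 * x)) at 1 by (field; lra).
    apply Rlt_le_trans with ((INR M + 1) * (2 * x)); [|lra].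
    apply Rmult_lt_compat_r; lra. }
  destruct (Rle_dec (INR n * x) 3) as [H3|H3].
  { apply alt_sin_sum_short; try assumption; lra. }
  destruct M as [|[|m]]; [simpl in HM2'; lra|simpl in HM2'; lra|].
  rewrite !S_INR in HM1', HM2'.
  set (N := (2 * S m + 1)%nat).
  assert (EN : INR N = 2 * INR m + 3).
  { unfold N. rewrite plus_INR, mult_INR, (S_INR m).
    change (INR 2) with 2. change (INR 1) with 1. ring. }
  assert (HnN : (N < n)%nat).
  { apply INR_lt. rewrite EN. pose proof (pos_INR m). nra. }
  rewrite (sum_n_m_Chasles _ 2 N n) by (unfold N; lia). change plus with Rplus.
  pose proof (pos_INR m) as Hm0.
  pose proof (alt_sin_sum_le_harmonic e x (S m) He ltac:(lra)
    ltac:(fold N; rewrite EN; nra)) as Hhead. fold N in Hhead.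
  pose proof (alt_harmonic_sum_half x (S m) ltac:(lra) ltac:(lia)
    ltac:(fold N; rewrite EN; nra)) as Hhalf. fold N in Hhalf.
  assert (HsN : 0 <= sin ((INR N + / 2) * x)) by (apply sin_ge_0; rewrite EN; nra).
  set (SN := sin ((INR N + / 2) * x)) in *.
  assert (Hc : 96 / 100 <= cos (x / 2)).
  { pose proof (cos_lower_quadratic (x / 2)). nra. }
  set (c := cos (x / 2)) in *.
  (* N + 1 is even: the lower end of the tail contributes SN with a plus sign *)
  assert (Htail : - (e (S N) * ((SN + 1) / (2 * c)))
    <= sum_n_m (fun k => e k * (- ((-1) ^ k * sin (INR k * x)))) (S N) n).
  { apply envelope_tail; [assumption|lia|]. intros q Hq.
    apply Rmult_le_reg_l with (2 * c); [lra|].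
    replace (2 * c * - ((SN + 1) / (2 * c))) with (- (SN + 1)) by (field; lra).
    pose proof (alt_sin_sum_telescope x (S N) q ltac:(lia)) as HT.
    fold c in HT.
    rewrite sum_n_m_R_opp.
    assert (Eeven : (-1) ^ S N = 1).
    { unfold N. replace (S (2 * S m + 1)) with (2 * (S (S m)))%nat by lia.
      apply pow_m1_even. }
    rewrite Eeven in HT.
    replace ((INR (S N) - / 2) * x) with ((INR N + / 2) * x) in HT
      by (rewrite S_INR; field).
    fold SN in HT.
    assert (Hq1 : Rabs ((-1) ^ q * sin ((INR q + / 2) * x)) <= 1).
    { rewrite Rabs_mult, pow_1_abs, Rmult_1_l. apply Rabs_le, SIN_bound. }
    apply Rabs_le_between in Hq1. lra. }
  rewrite (sum_n_m_R_ext (fun k => e k * - ((-1) ^ k * sin (INR k * x)))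
    (fun k => - ((-1) ^ k * (e k * sin (INR k * x))))), sum_n_m_R_opp
    in Htail by (intros; ring).
  set (A := sum_n_m (fun k => (-1) ^ k * (e k * sin (INR k * x))) 2 N) in *.
  set (T := sum_n_m (fun k => (-1) ^ k * (e k * sin (INR k * x))) (S N) n) in *.
  set (V := sum_n_m (fun k => (-1) ^ k * (sin (INR k * x) / INR k)) 2 N) in *.
  assert (HT : 2 * c * T <= e (S N) * (SN + 1)).
  { replace (e (S N) * (SN + 1)) with (2 * c * (e (S N) * ((SN + 1) / (2 * c))))
      by (field; lra). apply Rmult_le_compat_l; lra. }
  assert (HA : 2 * c * A <= 2 * c * V) by (apply Rmult_le_compat_l; lra).
  pose proof (env_le_inv e He (S N) ltac:(lia)) as Hle.
  pose proof (env_pos e He (S N) ltac:(lia)) as Hpos.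
  rewrite S_INR, EN in Hle.
  assert (HeN : e (S N) <= x / 2) by nra.
  assert (HeSN : e (S N) * SN <= SN / INR N).
  { apply Rmult_le_reg_r with (INR N); [rewrite EN; lra|].
    replace (SN / INR N * INR N) with SN by (field; rewrite EN; lra).
    assert (e (S N) * INR N <= 1) by (rewrite EN; nra). nra. }
  assert (H32 : sin (3 / 2 * x) <= 3 / 2 * x) by (left; apply sin_lt_x; lra).
  assert (H52 : sin (5 / 2 * x) <= 5 / 2 * x) by (left; apply sin_lt_x; lra).
  pose proof (sin_lower_cubic x ltac:(lra)) as Hsx.
  assert (Hsx' : 95 / 100 * x <= sin x) by nra.
  apply Rmult_le_reg_l with (2 * c); [lra|].
  apply Rle_trans with (170 / 100 * x); [lra|]. nra.
Qed.

Lemma sin_sum_nonneg (e : nat -> R) (t : R) (n : nat) :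
  envelope e -> 0 <= t <= PI -> (1 <= n)%nat ->
  0 <= sum_n_m (fun k => e k * sin (INR k * t)) 1 n.
Proof.
  intros He Ht Hn.
  destruct (Req_dec t 0) as [->|H0].
  { apply sum_n_m_R_nonneg. intros. rewrite Rmult_0_r, sin_0. lra. }
  destruct (Rle_dec t (PI - / 2)) as [H|H].
  { apply sin_sum_away_from_pi; [assumption|lra|assumption]. }
  destruct (Req_dec t PI) as [->|HPI].
  { apply sum_n_m_R_nonneg. intros.
    replace PI with (PI - 0) by ring. rewrite sin_mul_PI_minus, Rmult_0_r, sin_0. lra. }
  pose proof (alt_sin_sum_le e (PI - t) n He ltac:(lra) Hn) as HA.
  rewrite sin_PI_x in HA.
  destruct (le_lt_dec 2 n) as [H2|H2].
  - rewrite sum_n_m_R_head by assumption. rewrite (env_one e He).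
    rewrite (sum_n_m_R_ext (fun k => e k * sin (INR k * t))
      (fun k => - ((-1) ^ k * (e k * sin (INR k * (PI - t)))))).
    + rewrite sum_n_m_R_opp. simpl INR. rewrite Rmult_1_l, Rmult_1_l. lra.
    + intros k. replace t with (PI - (PI - t)) at 1 by ring. rewrite sin_mul_PI_minus. ring.
  - replace n with 1%nat by lia. rewrite sum_n_n, (env_one e He). simpl.
    rewrite !Rmult_1_l. apply sin_ge_0; lra.
Qed.

(** * Dominated sequences and power sums in the half-planes *)

(** Monotonicity of the quotients d_k / e_k: the property that nonincreasing
    weights preserve and that summation by parts against e requires. *)
Definition dominated (e d : nat -> R) : Prop :=
  forall k, (1 <= k)%nat -> 0 <= d k /\ d (S k) * e k <= d k * e (S k).

Lemma dominated_mul (e d w : nat -> R) :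
  envelope e -> dominated e d ->
  (forall k, (1 <= k)%nat -> 0 <= w (S k) <= w k) ->
  dominated e (fun k => d k * w k).
Proof.
  intros He Hd Hw k Hk. destruct (Hd k Hk) as [H0 H1].
  destruct (Hd (S k) ltac:(lia)) as [H0' _].
  pose proof (Hw k Hk) as Hwk. pose proof (env_pos e He k Hk) as Hek. split; [nra|].
  apply Rle_trans with (d (S k) * e k * w k).
  - replace (d (S k) * w (S k) * e k) with (d (S k) * e k * w (S k)) by ring.
    apply Rmult_le_compat_l; nra.
  - replace (d k * w k * e (S k)) with (d k * e (S k) * w k) by ring.
    apply Rmult_le_compat_r; lra.
Qed.

Lemma dominated_decr (e d : nat -> R) (k : nat) :
  envelope e -> dominated e d -> (1 <= k)%nat -> d (S k) <= d k.
Proof.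
  intros He Hd Hk. destruct (Hd k Hk) as [H0 H1].
  pose proof (env_pos e He k Hk). pose proof (env_decr e He k Hk).
  apply Rmult_le_reg_r with (e k); [assumption|]. nra.
Qed.

Lemma dominated_sum_ge (e d v : nat -> R) (B : R) (n : nat) :
  envelope e -> dominated e d -> (1 <= n)%nat ->
  (forall q, (1 <= q)%nat -> - B <= sum_n_m (fun k => e k * v k) 1 q) ->
  - (d 1%nat * B) <= sum_n_m (fun k => d k * v k) 1 n.
Proof.
  intros He Hd Hn Hv.
  assert (HA := abel_lower_bound (fun k => d k / e k) (fun k => e k * v k) B 1 n Hn).
  cbv beta in HA. rewrite (env_one e He), Rdiv_1_r in HA.
  rewrite (sum_n_m_ext_loc (fun k => d k * v k) (fun k => d k / e k * (e k * v k))).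
  2:{ intros k Hk. pose proof (env_pos e He k ltac:(lia)).
      change (d k * v k = d k / e k * (e k * v k)). field. lra. }
  apply HA.
  - intros k Hk. apply Rdiv_le_0_compat; [apply Hd|apply (env_pos e He)]; lia.
  - intros k Hk. destruct (Hd k ltac:(lia)) as [_ H].
    pose proof (env_pos e He k ltac:(lia)) as Hk0.
    pose proof (env_pos e He (S k) ltac:(lia)) as Hk1.
    apply Rmult_le_reg_r with (e k * e (S k)); [now apply Rmult_lt_0_compat|].
    replace (d (S k) / e (S k) * (e k * e (S k))) with (d (S k) * e k) by (field; lra).
    replace (d k / e k * (e k * e (S k))) with (d k * e (S k)) by (field; lra).
    exact H.
  - intros q Hq. apply Hv. lia.
Qed.

Definition psum (d : nat -> R) (n : nat) (z : C) : C :=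
  sum_n (fun k => (RtoC (d k) * z ^ k)%C) n.

Lemma psum_S (d : nat -> R) (n : nat) (z : C) :
  psum d (S n) z = (psum d n z + RtoC (d (S n)) * z ^ S n)%C.
Proof. unfold psum. now rewrite sum_Sn. Qed.

Lemma psum_0 (d : nat -> R) (z : C) : psum d 0 z = RtoC (d 0%nat).
Proof. unfold psum. rewrite sum_O. simpl. apply Cmult_1_r. Qed.

Lemma psum_conj (d : nat -> R) (n : nat) (z : C) :
  psum d n (Cconj z) = Cconj (psum d n z).
Proof.
  assert (HR : forall x : R, Cconj (RtoC x) = RtoC x).
  { intros x. unfold Cconj, RtoC; simpl. now rewrite Ropp_0. }
  induction n as [|n IH].
  - now rewrite !psum_0, HR.
  - now rewrite !psum_S, IH, Cplus_conj, Cmult_conj, HR, Cpow_conj.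
Qed.

Lemma pow_polar (z : C) :
  0 <= Im z -> exists t, 0 <= t <= PI /\
  forall k, Re (z ^ k)%C = Cmod z ^ k * cos (INR k * t)
         /\ Im (z ^ k)%C = Cmod z ^ k * sin (INR k * t).
Proof.
  intros Him.
  assert (Hz : exists t, 0 <= t <= PI /\
    Re z = Cmod z * cos t /\ Im z = Cmod z * sin t).
  { destruct (Req_dec (Cmod z) 0) as [H0|H0].
    - apply Cmod_eq_0 in H0. subst z. exists 0. rewrite Cmod_0. simpl.
      pose proof PI_RGT_0. lra.
    - assert (Hr : 0 < Cmod z) by (pose proof (Cmod_ge_0 z); lra).
      exists (acos (Re z / Cmod z)). split; [apply acos_bound|].
      pose proof (Cmod2_alt z) as H2. rewrite <- !Rsqr_pow2 in H2.
      assert (HR : (Re z / Cmod z)² = 1 - (Im z / Cmod z)²).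
      { rewrite !Rsqr_div'. replace ((Re z)²) with ((Cmod z)² - (Im z)²) by lra.
        unfold Rsqr. field. lra. }
      assert (Hb : -1 <= Re z / Cmod z <= 1).
      { pose proof (Rle_0_sqr (Im z / Cmod z)) as Hq. unfold Rsqr in HR, Hq. nra. }
      rewrite cos_acos, sin_acos by assumption. split; [field; lra|].
      rewrite HR. replace (1 - (1 - (Im z / Cmod z)²)) with ((Im z / Cmod z)²) by ring.
      rewrite sqrt_Rsqr; [field; lra|]. apply Rdiv_le_0_compat; assumption. }
  destruct Hz as [t [Ht [Hre Him']]]. exists t. split; [assumption|].
  induction k as [|k [IHr IHi]].
  - simpl. rewrite Rmult_0_l, cos_0, sin_0. lra.
  - rewrite Cpow_S, re_mult, im_mult, IHr, IHi, Hre, Him', S_INR.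
    replace ((INR k + 1) * t) with (t + INR k * t) by ring.
    rewrite cos_plus, sin_plus. simpl. split; ring.
Qed.

Lemma psum_polar (d : nat -> R) (r t : R) (z : C) (n : nat) :
  (forall k, Re (z ^ k)%C = r ^ k * cos (INR k * t)
          /\ Im (z ^ k)%C = r ^ k * sin (INR k * t)) ->
  (1 <= n)%nat ->
  Re (psum d n z) = d 0%nat + sum_n_m (fun k => d k * r ^ k * cos (INR k * t)) 1 n
  /\ Im (psum d n z) = sum_n_m (fun k => d k * r ^ k * sin (INR k * t)) 1 n.
Proof.
  intros Hz Hn. destruct n as [|n]; [lia|]. clear Hn.
  induction n as [|n [IHr IHi]].
  - rewrite psum_S, psum_0, !sum_n_n. rewrite re_plus, im_plus, re_scal_l, im_scal_l.
    destruct (Hz 1%nat) as [-> ->]. simpl. split; ring.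
  - rewrite psum_S, !(sum_n_m_R_Sm _ 1 (S n)) by lia.
    rewrite re_plus, im_plus, re_scal_l, im_scal_l, IHr, IHi.
    destruct (Hz (S (S n))) as [-> ->]. split; ring.
Qed.

(** The constant d_0 - d_1 |z| is what the cosine inequality leaves once its
    summand 1 is weighted by d_1 |z|; it is positive inside the disk when
    0 <= d_1 <= d_0 and d_0 > 0, uniformly in n, so strictness survives the
    limit. *)
Lemma psum_upper (e d : nat -> R) (n : nat) (z : C) :
  envelope e -> dominated e d -> Cmod z <= 1 -> 0 <= Im z ->
  d 0%nat - d 1%nat * Cmod z <= Re (psum d n z) /\ 0 <= Im (psum d n z).
Proof.
  intros He Hd Hz Him. pose proof (Cmod_ge_0 z) as Hr0.
  destruct (Hd 1%nat (le_n _)) as [Hd1 _].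
  destruct n as [|n].
  { rewrite psum_0, re_RtoC, im_RtoC. nra. }
  destruct (pow_polar z Him) as [t [Ht Hp]].
  destruct (psum_polar d (Cmod z) t z (S n) Hp ltac:(lia)) as [-> ->].
  assert (Hdr : dominated e (fun k => d k * Cmod z ^ k)).
  { apply dominated_mul; [assumption|assumption|]. intros k _.
    pose proof (pow_le (Cmod z) k Hr0). simpl. nra. }
  split.
  - pose proof (dominated_sum_ge e _ (fun k => cos (INR k * t)) 1 (S n)
      He Hdr ltac:(lia) (fun q Hq => cos_sum_ge e t q He Ht Hq)) as H.
    cbv beta in H. lra.
  - pose proof (dominated_sum_ge e _ (fun k => sin (INR k * t)) 0 (S n)
      He Hdr ltac:(lia)) as H'.
    cbv beta in H'. rewrite Rmult_0_r, Ropp_0 in H'. apply H'.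
    intros q Hq. apply sin_sum_nonneg; assumption.
Qed.

Lemma psum_typically_real (e d : nat -> R) (n : nat) (z : C) :
  envelope e -> dominated e d -> Cmod z <= 1 ->
  d 0%nat - d 1%nat * Cmod z <= Re (psum d n z)
  /\ (0 <= Im z -> 0 <= Im (psum d n z))
  /\ (Im z <= 0 -> Im (psum d n z) <= 0).
Proof.
  intros He Hd Hz.
  assert (Hlow : Im z <= 0 ->
    d 0%nat - d 1%nat * Cmod z <= Re (psum d n z) /\ Im (psum d n z) <= 0).
  { intros H. destruct (psum_upper e d n (Cconj z) He Hd) as [H1 H2].
    - now rewrite Cmod_conj.
    - rewrite im_conj. lra.
    - rewrite psum_conj, re_conj, Cmod_conj in H1.
      rewrite psum_conj, im_conj in H2. split; [assumption|lra]. }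
  pose proof (psum_upper e d n z He Hd Hz) as Hup.
  destruct (Rle_dec 0 (Im z)) as [H|H].
  - repeat split; [now apply Hup|now apply Hup|now apply Hlow].
  - repeat split; [apply Hlow; lra|now apply Hup|now apply Hlow].
Qed.

(** * Limits and derivatives of complex power series *)

(** Convergence in C by coordinates, so that the calculus of real limits
    applies. *)
Definition Clim (u : nat -> C) (l : C) : Prop :=
  is_lim_seq (fun n => Re (u n)) (Re l) /\ is_lim_seq (fun n => Im (u n)) (Im l).

Lemma Clim_filterlim (u : nat -> C) (l : C) :
  Clim u l <-> filterlim u eventually (locally l).
Proof.
  split.
  - intros [Hr Hi]. apply filterlim_locally. intros eps.
    pose proof (proj1 (filterlim_locally _ _) Hr eps) as Hr'.
    pose proof (proj1 (filterlim_locally _ _) Hi eps) as Hi'.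
    generalize (filter_and _ _ Hr' Hi'). apply filter_imp. intros n Hn. exact Hn.
  - intros H. pose proof (proj1 (filterlim_locally _ _) H) as H'.
    split; apply filterlim_locally; intros eps; generalize (H' eps);
      apply filter_imp; intros n [H1 H2]; assumption.
Qed.

Lemma Clim_plus (u v : nat -> C) (l m : C) :
  Clim u l -> Clim v m -> Clim (fun n => u n + v n)%C (l + m)%C.
Proof. intros [H1 H2] [H3 H4]. split; simpl; now apply is_lim_seq_plus'. Qed.

Lemma Clim_scal (c : C) (u : nat -> C) (l : C) :
  Clim u l -> Clim (fun n => c * u n)%C (c * l)%C.
Proof.
  intros [H1 H2].
  split; simpl; [apply is_lim_seq_minus' | apply is_lim_seq_plus'];
    apply (is_lim_seq_scal_l _ _ (Finite _)); assumption.
Qed.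

Lemma Clim_ext (u v : nat -> C) (l : C) :
  (forall n, u n = v n) -> Clim u l -> Clim v l.
Proof.
  intros H [H1 H2]. split; eapply is_lim_seq_ext; try eassumption;
    intros n; simpl; now rewrite H.
Qed.

Lemma Clim_unique (u : nat -> C) (l m : C) : Clim u l -> Clim u m -> l = m.
Proof.
  intros [H1 H2] [H3 H4].
  apply is_lim_seq_unique in H1, H2, H3, H4.
  rewrite H1 in H3. rewrite H2 in H4.
  destruct l, m. injection H3. injection H4. simpl. now intros -> ->.
Qed.

Lemma Clim_Cmod_le (u : nat -> C) (l : C) (M : R) :
  Clim u l -> (forall n, Cmod (u n) <= M) -> Cmod l <= M.
Proof.
  intros [H1 H2] H.
  assert (HM : 0 <= M) by (eapply Rle_trans; [apply Cmod_ge_0|apply (H 0%nat)]).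
  apply Rsqr_incr_0_var; [|assumption].
  rewrite !Rsqr_pow2, Cmod2_alt.
  assert (HL : is_lim_seq (fun n => Re (u n) ^ 2 + Im (u n) ^ 2)
    (Re l ^ 2 + Im l ^ 2)).
  { assert (Hsq : forall (x : nat -> R) (a : R), is_lim_seq x a ->
      is_lim_seq (fun n => x n ^ 2) (a ^ 2)).
    { intros x a Hx. exact (is_lim_seq_mult' _ _ _ _ Hx
        (is_lim_seq_mult' _ _ _ _ Hx (is_lim_seq_const 1))). }
    exact (is_lim_seq_plus' _ _ _ _ (Hsq _ _ H1) (Hsq _ _ H2)). }
  eapply (is_lim_seq_le _ _ (Finite _) (Finite _) _ HL (is_lim_seq_const (M ^ 2))).
  Unshelve. intros n. cbv beta. rewrite <- Cmod2_alt. apply pow_incr.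
  split; [apply Cmod_ge_0|apply H].
Qed.

Lemma Clim_of_summable (d m : nat -> R) (z : C) :
  (forall k, Cmod (RtoC (d k) * z ^ k) <= m k) -> ex_series m ->
  exists l, Clim (fun n => psum d n z) l.
Proof.
  intros Hm Hs.
  assert (H1 : ex_series (fun k => Re (RtoC (d k) * z ^ k)%C)).
  { apply (ex_series_le (V := R_CompleteNormedModule) _ m); [|assumption].
    intros k. eapply Rle_trans; [apply re_le_Cmod|apply Hm]. }
  assert (H2 : ex_series (fun k => Im (RtoC (d k) * z ^ k)%C)).
  { apply (ex_series_le (V := R_CompleteNormedModule) _ m); [|assumption].
    intros k. eapply Rle_trans; [|apply Hm].
    eapply Rle_trans; [apply Rmax_r|apply Rmax_Cmod]. }
  destruct H1 as [lr H1], H2 as [li H2]. exists (lr, li).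
  assert (E : forall n,
      sum_n (fun k => Re (RtoC (d k) * z ^ k)%C) n = Re (psum d n z)
   /\ sum_n (fun k => Im (RtoC (d k) * z ^ k)%C) n = Im (psum d n z)).
  { induction n as [|n [IH1 IH2]].
    - unfold psum. now rewrite !sum_O.
    - now rewrite !sum_Sn, IH1, IH2, psum_S, re_plus, im_plus. }
  split.
  - apply is_lim_seq_ext with (2 := H1). intros n. apply E.
  - apply is_lim_seq_ext with (2 := H2). intros n. apply E.
Qed.

Lemma ex_series_sqr_geom (rho : R) :
  0 < rho < 1 -> ex_series (fun k => (INR k + 1) ^ 2 * rho ^ k).
Proof.
  intros Hr.
  assert (Hpos : forall k, 0 < (INR k + 1) ^ 2 * rho ^ k).
  { intros k. pose proof (pos_INR k).
    apply Rmult_lt_0_compat; apply pow_lt; lra. }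
  apply ex_series_ext with (fun k => Rabs ((INR k + 1) ^ 2 * rho ^ k)).
  { intros k. apply Rabs_pos_eq. left. apply Hpos. }
  apply ex_series_DAlembert with rho; [lra| |].
  { intros k. specialize (Hpos k). lra. }
  apply is_lim_seq_ext with (fun k => (1 + / (INR (S k))) * (1 + / (INR (S k))) * rho).
  { intros k. rewrite Rabs_pos_eq.
    2:{ left. apply Rdiv_lt_0_compat; apply Hpos. }
    rewrite !S_INR. pose proof (pos_INR k). pose proof (pow_lt rho k ltac:(lra)).
    simpl. field. lra. }
  assert (HL : is_lim_seq (fun k => 1 + / INR (S k)) 1).
  { replace (Finite 1) with (Finite (1 + 0)) by (f_equal; ring).
    apply is_lim_seq_plus'; [apply is_lim_seq_const|].
    apply (is_lim_seq_incr_1 (fun k => / INR k)).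
    apply (is_lim_seq_inv _ p_infty); [apply is_lim_seq_INR|discriminate]. }
  replace (Finite rho) with (Finite (1 * 1 * rho)) by (f_equal; ring).
  exact (is_lim_seq_mult' _ _ _ _ (is_lim_seq_mult' _ _ _ _ HL HL)
    (is_lim_seq_const rho)).
Qed.

(** The remainder R_k of the expansion of w^(k+1) at z satisfies
    R_(k+1) = w R_k + (k+1) z^k (w-z)^2. *)
Lemma pow_remainder_le (z w : C) (rho : R) (k : nat) :
  Cmod z <= rho -> Cmod w <= rho ->
  Cmod (w ^ S k - z ^ S k - RtoC (INR k + 1) * z ^ k * (w - z)) * rho
  <= (INR k + 1) ^ 2 * rho ^ k * Cmod (w - z) ^ 2.
Proof.
  intros Hz Hw. pose proof (Cmod_ge_0 z) as Hz0. pose proof (Cmod_ge_0 w) as Hw0.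
  induction k as [|k IH].
  - replace (w ^ 1 - z ^ 1 - RtoC (INR 0 + 1) * z ^ 0 * (w - z))%C with (RtoC 0).
    + rewrite Cmod_0. simpl. pose proof (pow2_ge_0 (Cmod (w - z))) as H. simpl in H. lra.
    + simpl INR. rewrite Rplus_0_l. simpl. ring.
  - pose proof (pos_INR k) as Hk.
    set (D := (w ^ S k - z ^ S k - RtoC (INR k + 1) * z ^ k * (w - z))%C) in *.
    replace (w ^ S (S k) - z ^ S (S k) - RtoC (INR (S k) + 1) * z ^ S k * (w - z))%C
      with (w * D + RtoC (INR k + 1) * z ^ k * (w - z) ^ 2)%C.
    2:{ unfold D. rewrite S_INR, !RtoC_plus, !Cpow_S. ring. }
    set (h := Cmod (w - z)) in *.
    assert (HD : Cmod (w * D + RtoC (INR k + 1) * z ^ k * (w - z) ^ 2)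
      <= Cmod w * Cmod D + (INR k + 1) * Cmod z ^ k * h ^ 2).
    { eapply Rle_trans; [apply Cmod_triangle|].
      rewrite !Cmod_mult, Cmod_R, !Cmod_pow, Rabs_pos_eq by lra. apply Rle_refl. }
    assert (Hrk : Cmod z ^ k <= rho ^ k) by (apply pow_incr; lra).
    pose proof (pow_le (Cmod z) k Hz0) as Hzk.
    pose proof (Cmod_ge_0 D) as HD0. pose proof (pow2_ge_0 h) as Hh.
    apply Rle_trans with ((rho * Cmod D + (INR k + 1) * rho ^ k * h ^ 2) * rho).
    { apply Rmult_le_compat_r; [lra|]. eapply Rle_trans; [exact HD|].
      apply Rplus_le_compat; [now apply Rmult_le_compat_r|].
      apply Rmult_le_compat_r; [assumption|]. apply Rmult_le_compat_l; lra. }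
    assert (H1 : rho * (Cmod D * rho) <= rho * ((INR k + 1) ^ 2 * rho ^ k * h ^ 2))
      by (apply Rmult_le_compat_l; lra).
    rewrite S_INR.
    assert (HX : 0 <= rho ^ k * h ^ 2 * rho).
    { apply Rmult_le_pos; [|lra]. apply Rmult_le_pos; lra. }
    apply Rle_trans with
      (((INR k + 1) ^ 2 + (INR k + 1)) * (rho ^ k * h ^ 2 * rho)); [lra|].
    replace ((INR k + 1 + 1) ^ 2 * rho ^ S k * h ^ 2)
      with ((INR k + 1 + 1) ^ 2 * (rho ^ k * h ^ 2 * rho)) by (simpl; ring).
    apply Rmult_le_compat_r; nra.
Qed.

Lemma psum_remainder_le (c : nat -> R) (z w : C) (rho : R) (n : nat) :
  (forall k, Rabs (c k) <= 1) -> 0 < rho -> Cmod z <= rho -> Cmod w <= rho ->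
  Cmod (w * psum c n w - z * psum c n z
        - psum (fun k => (INR k + 1) * c k) n z * (w - z)) * rho
  <= sum_n (fun k => (INR k + 1) ^ 2 * rho ^ k) n * Cmod (w - z) ^ 2.
Proof.
  intros Hc Hrho Hz Hw.
  assert (Hk : forall k, Cmod (RtoC (c k)
      * (w ^ S k - z ^ S k - RtoC (INR k + 1) * z ^ k * (w - z))) * rho
      <= (INR k + 1) ^ 2 * rho ^ k * Cmod (w - z) ^ 2).
  { intros k. eapply Rle_trans; [|now apply pow_remainder_le].
    rewrite Cmod_mult, Cmod_R. apply Rmult_le_compat_r; [lra|].
    rewrite <- (Rmult_1_l (Cmod _)) at 2.
    apply Rmult_le_compat_r; [apply Cmod_ge_0|apply Hc]. }
  induction n as [|n IH].
  - rewrite !psum_0, sum_O. eapply Rle_trans; [|apply Hk].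
    right. do 2 f_equal. rewrite RtoC_mult. simpl. ring.
  - rewrite !psum_S, sum_Sn. change plus with Rplus.
    rewrite (Rmult_plus_distr_r _ _ (Cmod (w - z) ^ 2)).
    eapply Rle_trans; [|apply Rplus_le_compat; [exact IH|apply Hk]].
    rewrite <- Rmult_plus_distr_r. apply Rmult_le_compat_r; [lra|].
    eapply Rle_trans; [|apply Cmod_triangle]. right. f_equal.
    rewrite RtoC_mult, !(Cpow_S _ (S n)). ring.
Qed.

Lemma is_C_derive_of_quadratic_bound (f : C -> C) (z l : C) (delta K : R) :
  0 < delta ->
  (forall w, Cmod (w - z) < delta ->
     Cmod (f w - f z - l * (w - z)) <= K * Cmod (w - z) ^ 2) ->
  @is_derive C_AbsRing C_NormedModule f z l.
Proof.
  intros Hdelta HK. split.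
  { apply is_linear_scal_l. }
  intros x Hx eps.
  assert (x = z) as ->.
  { symmetry. 
    exact (is_filter_lim_locally_unique (V := AbsRing_NormedModule C_AbsRing) z x Hx). }
  assert (HK1 : 0 < Rabs K + 1) by (pose proof (Rabs_pos K); lra).
  assert (Hd : 0 < Rmin delta (eps / (Rabs K + 1))).
  { apply Rmin_pos; [assumption|]. apply Rdiv_lt_0_compat; [apply eps|assumption]. }
  exists (mkposreal _ Hd). intros w Hw.
  assert (Hw' : Cmod (w - z) < Rmin delta (eps / (Rabs K + 1))) by exact Hw.
  change (Cmod (f w - f z - (w - z) * l) <= eps * Cmod (w - z)).
  rewrite (Cmult_comm (w - z) l).
  pose proof (Rmin_l delta (eps / (Rabs K + 1))).
  pose proof (Rmin_r delta (eps / (Rabs K + 1))).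
  eapply Rle_trans; [apply HK; lra|].
  pose proof (Cmod_ge_0 (w - z)) as Hh0. pose proof (Rle_abs K).
  set (h := Cmod (w - z)) in *. simpl. rewrite Rmult_1_r, <- Rmult_assoc.
  apply Rmult_le_compat_r; [assumption|].
  apply Rle_trans with ((Rabs K + 1) * h); [apply Rmult_le_compat_r; lra|].
  replace (pos eps) with ((Rabs K + 1) * (eps / (Rabs K + 1))) by (field; lra).
  apply Rmult_le_compat_l; lra.
Qed.

(** On the disk of radius rho = (1+|z|)/2 the remainders of the partial sums are
    at most (sum of (k+1)^2 rho^k) |w-z|^2 / rho, uniformly in n. *)
Lemma power_series_derive (c : nat -> R) (f : C -> C) (z : C) :
  (forall k, Rabs (c k) <= 1) ->
  (forall w, unit_disk w -> Clim (fun n => w * psum c n w)%C (f w)) ->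
  unit_disk z ->
  exists l : C, Clim (fun n => psum (fun k => ((INR k + 1) * c k)%R) n z) l
    /\ @is_derive C_AbsRing C_NormedModule f z l.
Proof.
  unfold unit_disk. intros Hc Hf Hz.
  pose proof (Cmod_ge_0 z) as Hz0.
  set (rho := (1 + Cmod z) / 2).
  assert (Hrho : 0 < rho < 1) by (unfold rho; lra).
  assert (Hzr : Cmod z <= rho) by (unfold rho; lra).
  pose proof (ex_series_sqr_geom rho Hrho) as Hs.
  destruct (Clim_of_summable (fun k => (INR k + 1) * c k)
    (fun k => (INR k + 1) ^ 2 * rho ^ k) z) as [l Hl]; [|exact Hs|].
  { intros k. rewrite Cmod_mult, Cmod_R, Cmod_pow, Rabs_mult.
    pose proof (pos_INR k). rewrite (Rabs_pos_eq (INR k + 1)) by lra.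
    pose proof (Hc k). pose proof (Rabs_pos (c k)).
    apply Rmult_le_compat; [nra|now apply pow_le|nra|]. apply pow_incr. lra. }
  exists l. split; [exact Hl|].
  destruct Hs as [S0 HS].
  assert (HS' : forall n, sum_n (fun k => (INR k + 1) ^ 2 * rho ^ k) n <= S0).
  { apply is_lim_seq_incr_compare; [exact HS|]. intros n. rewrite sum_Sn.
    change plus with Rplus. pose proof (pow_le rho (S n) ltac:(lra)).
    pose proof (pow2_ge_0 (INR (S n) + 1)). nra. }
  apply (is_C_derive_of_quadratic_bound f z l (rho - Cmod z) (S0 / rho)).
  { unfold rho; lra. }
  intros w Hw.
  assert (Hwr : Cmod w <= rho).
  { replace w with (z + (w - z))%C by ring.
    eapply Rle_trans; [apply Cmod_triangle|lra]. }
  apply Clim_Cmod_le with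
    (fun n => w * psum c n w - z * psum c n z
        - psum (fun k => ((INR k + 1) * c k)%R) n z * (w - z))%C.
  - apply Clim_ext with (fun n => w * psum c n w + (- RtoC 1) * (z * psum c n z)
        + (- (w - z)) * psum (fun k => ((INR k + 1) * c k)%R) n z)%C.
    { intros n. ring. }
    replace (f w - f z - l * (w - z))%C
      with (f w + (- RtoC 1) * f z + (- (w - z)) * l)%C by ring.
    apply Clim_plus; [apply Clim_plus; [|apply Clim_scal]|now apply Clim_scal];
      apply Hf; unfold unit_disk; lra.
  - intros n. pose proof (psum_remainder_le c z w rho n Hc ltac:(lra) Hzr Hwr) as H.
    apply Rmult_le_reg_r with rho; [lra|]. eapply Rle_trans; [exact H|].
    replace (S0 / rho * Cmod (w - z) ^ 2 * rho) with (S0 * Cmod (w - z) ^ 2)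
      by (field; lra).
    apply Rmult_le_compat_r; [apply pow2_ge_0|apply HS'].
Qed.

(** * Starlikeness of dominated power series *)

Lemma fpoly_S (b : nat -> R) (n : nat) (z : C) :
  b 1%nat = 1 -> fpoly b (S n) z = (z * psum (fun k => b (S k)) n z)%C.
Proof.
  intros Hb. induction n as [|n IH].
  - rewrite psum_0, Hb. unfold fpoly. rewrite sum_n_m_zero by lia.
    change (z + RtoC 0 = z * RtoC 1)%C. ring.
  - rewrite psum_S, Cmult_plus_distr_l, <- IH. unfold fpoly.
    rewrite (sum_n_Sm _ 2 (S n)) by lia.
    change plus with Cplus. rewrite (Cpow_S z (S n)). ring.
Qed.

Lemma Re_div_pos (g f : C) : 0 < Re g -> 0 < Re f -> 0 <= Im g * Im f ->
  0 < Re (g / f)%C.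
Proof.
  intros Hg Hf Hi. destruct g as [g1 g2], f as [f1 f2]. simpl in *.
  replace (g1 * (f1 / (f1 * (f1 * 1) + f2 * (f2 * 1)))
    - g2 * (- f2 / (f1 * (f1 * 1) + f2 * (f2 * 1))))
    with ((g1 * f1 + g2 * f2) / (f1 ^ 2 + f2 ^ 2)) by (field; nra).
  apply Rdiv_lt_0_compat; nra.
Qed.

Lemma Clim_incr_1 (u : nat -> C) (l : C) :
  Clim u l <-> Clim (fun n => u (S n)) l.
Proof.
  split; intros [H1 H2]; split.
  - exact (proj1 (is_lim_seq_incr_1 (fun n => Re (u n)) _) H1).
  - exact (proj1 (is_lim_seq_incr_1 (fun n => Im (u n)) _) H2).
  - exact (proj2 (is_lim_seq_incr_1 (fun n => Re (u n)) _) H1).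
  - exact (proj2 (is_lim_seq_incr_1 (fun n => Im (u n)) _) H2).
Qed.

Lemma Clim_const (l : C) : Clim (fun _ => l) l.
Proof. split; apply is_lim_seq_const. Qed.

Lemma Clim_psum_typically_real (e d : nat -> R) (z l : C) :
  envelope e -> dominated e d -> Cmod z <= 1 -> Clim (fun n => psum d n z) l ->
  d 0%nat - d 1%nat * Cmod z <= Re l
  /\ (0 <= Im z -> 0 <= Im l) /\ (Im z <= 0 -> Im l <= 0).
Proof.
  intros He Hd Hz [Hr Hi].
  pose proof (fun n => psum_typically_real e d n z He Hd Hz) as H.
  split; [|split; intros Him].
  - refine (is_lim_seq_le _ _ (Finite _) (Finite _) _ (is_lim_seq_const _) Hr).
    intros n; apply H.
  - refine (is_lim_seq_le _ _ (Finite _) (Finite _) _ (is_lim_seq_const _) Hi).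
    intros n; now apply H.
  - refine (is_lim_seq_le _ _ (Finite _) (Finite _) _ Hi (is_lim_seq_const _)).
    intros n; now apply H.
Qed.

Lemma Clim_psum_of_bounded (c : nat -> R) (z : C) :
  (forall k, Rabs (c k) <= 1) -> unit_disk z ->
  exists l, Clim (fun n => psum c n z) l.
Proof.
  intros Hc Hz. apply Clim_of_summable with (fun k => Cmod z ^ k).
  - intros k. rewrite Cmod_mult, Cmod_R, Cmod_pow.
    pose proof (pow_le (Cmod z) k (Cmod_ge_0 z)). pose proof (Hc k). nra.
  - exists (/ (1 - Cmod z)). apply is_series_geom.
    rewrite Rabs_pos_eq; [exact Hz|apply Cmod_ge_0].
Qed.

Lemma psum_at_0 (d : nat -> R) (n : nat) : psum d n (RtoC 0) = RtoC (d 0%nat).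
Proof.
  induction n as [|n IH]; [apply psum_0|].
  rewrite psum_S, IH, Cpow_S. ring.
Qed.

Lemma dominated_ext (e d d' : nat -> R) :
  (forall k, d k = d' k) -> dominated e d -> dominated e d'.
Proof. intros H Hd k Hk. rewrite <- !H. now apply Hd. Qed.

(** Passing from G to F multiplies the coefficients by the decreasing weights
    1/(k+1-gamma). *)
Lemma dominated_coefficients (e b : nat -> R) (gamma : R) :
  envelope e -> 0 <= gamma < 1 ->
  dominated e (fun k => (INR k + 1 - gamma) * b (S k)) ->
  dominated e (fun k => b (S k)).
Proof.
  intros He Hg Hd.
  apply dominated_ext with
    (fun k => (INR k + 1 - gamma) * b (S k) * / (INR k + 1 - gamma)).
  { intros k. pose proof (pos_INR k). field. lra. }
  apply dominated_mul; [assumption|assumption|]. intros k Hk.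
  rewrite S_INR. pose proof (pos_INR k).
  split; [left; apply Rinv_0_lt_compat; lra|apply Rinv_le_contravar; lra].
Qed.

Lemma dominated_bounded (e b : nat -> R) (gamma : R) :
  envelope e -> 0 <= gamma < 1 -> b 1%nat = 1 ->
  (2 - gamma) * b 2%nat <= 1 - gamma ->
  dominated e (fun k => b (S k)) ->
  forall k, Rabs (b (S k)) <= 1.
Proof.
  intros He Hg Hb1 Hb2 Hc [|k]; [rewrite Hb1, Rabs_R1; lra|].
  rewrite Rabs_pos_eq by (apply (Hc (S k)); lia).
  induction k as [|k IH].
  - destruct (Hc 1%nat (le_n _)) as [H _]. nra.
  - eapply Rle_trans; [|exact IH].
    apply (dominated_decr e (fun k => b (S k))); [assumption..|lia].
Qed.

Lemma starlike_of_dominated (e b : nat -> R) (gamma : R) (f : C -> C) :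
  envelope e -> 0 <= gamma < 1 -> b 1%nat = 1 ->
  (2 - gamma) * b 2%nat <= 1 - gamma ->
  dominated e (fun k => (INR k + 1 - gamma) * b (S k)) ->
  (forall z, unit_disk z -> Clim (fun n => fpoly b n z) (f z)) ->
  starlike gamma f.
Proof.
  intros He Hg Hb1 Hb2 Hd Hf.
  set (c := fun k => b (S k)).
  set (d := fun k => (INR k + 1 - gamma) * b (S k)) in *.
  assert (Hc : dominated e c) by (apply dominated_coefficients with gamma; assumption).
  assert (Hcb : forall k, Rabs (c k) <= 1).
  { now apply dominated_bounded with e gamma. }
  assert (Hc1 : 0 <= c 1%nat <= 1).
  { pose proof (Hcb 1%nat) as H1. destruct (Hc 1%nat (le_n _)) as [H0 _].
    rewrite Rabs_pos_eq in H1 by exact H0. lra. }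
  assert (Hf' : forall z, unit_disk z -> Clim (fun n => z * psum c n z)%C (f z)).
  { intros z Hz. apply Clim_ext with (fun n => fpoly b (S n) z).
    - intros n. now apply fpoly_S.
    - apply (Clim_incr_1 (fun n => fpoly b n z)). now apply Hf. }
  (* f(z) = z F, f'(z) = H, and H - gamma F = G *)
  assert (Hmain : forall z, unit_disk z -> exists F H G : C,
    f z = (z * F)%C /\ @is_derive C_AbsRing C_NormedModule f z H
    /\ Clim (fun n => psum (fun k => (INR k + 1) * c k) n z) H
    /\ H = (G + RtoC gamma * F)%C
    /\ 0 < Re F /\ 0 < Re G /\ 0 <= Im G * Im F).
  { intros z Hz.
    destruct (Clim_psum_of_bounded c z Hcb Hz) as [F HF].
    destruct (power_series_derive c f z Hcb Hf' Hz) as [H [HH HD]].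
    exists F, H, (H + (- RtoC gamma) * F)%C.
    assert (HG : Clim (fun n => psum d n z) (H + (- RtoC gamma) * F)%C).
    { apply Clim_ext with
        (fun n => psum (fun k => ((INR k + 1) * c k)%R) n z
                  + (- RtoC gamma) * psum c n z)%C.
      - intros n. induction n as [|n IH].
        + rewrite !psum_0, <- RtoC_opp, <- RtoC_mult, <- RtoC_plus.
          f_equal. unfold d, c. ring.
        + rewrite !psum_S, <- IH. unfold d at 1.
          replace ((INR (S n) + 1 - gamma) * b (S (S n)))
            with ((INR (S n) + 1) * c (S n) + - gamma * c (S n)) by (unfold c; ring).
          rewrite RtoC_plus, (RtoC_mult (- gamma)), RtoC_opp. ring.
      - apply Clim_plus; [assumption|]. now apply Clim_scal. }
    unfold unit_disk in Hz. pose proof (Cmod_ge_0 z) as Hr0.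
    destruct (Clim_psum_typically_real e c z F He Hc ltac:(lra) HF)
      as [HF1 [HF2 HF3]].
    destruct (Clim_psum_typically_real e d z _ He Hd ltac:(lra) HG)
      as [HG1 [HG2 HG3]].
    set (G := (H + (- RtoC gamma) * F)%C) in *.
    assert (Hc0 : c 0%nat = 1) by exact Hb1.
    assert (Hd0 : d 0%nat = 1 - gamma) by (unfold d; rewrite Hb1; simpl; ring).
    assert (Hd1 : d 1%nat <= 1 - gamma).
    { unfold d. change (INR 1) with 1. lra. }
    assert (Hd1' : 0 <= d 1%nat) by apply (Hd 1%nat (le_n _)).
    refine (conj _ (conj HD (conj HH (conj _ (conj _ (conj _ _)))))).
    - apply Clim_unique with (fun n => z * psum c n z)%C; [now apply Hf'|].
      now apply Clim_scal.
    - unfold G. ring.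
    - nra.
    - nra.
    - destruct (Rle_dec 0 (Im z)) as [Hz0|Hz0].
      + specialize (HF2 Hz0). specialize (HG2 Hz0). nra.
      + specialize (HF3 ltac:(lra)). specialize (HG3 ltac:(lra)). nra. }
  assert (H0 : unit_disk (RtoC 0)) by (unfold unit_disk; rewrite Cmod_0; lra).
  split; [split; [|split]|].
  - intros z Hz. destruct (Hmain z Hz) as [F [H [G [_ [HD _]]]]]. now exists H.
  - destruct (Hmain _ H0) as [F [H [G [-> _]]]]. ring.
  - destruct (Hmain _ H0) as [F [H [G [_ [HD [HH _]]]]]].
    rewrite (is_C_derive_unique _ _ _ HD).
    apply Clim_unique with (1 := HH).
    apply Clim_ext with (fun _ => RtoC 1); [|apply Clim_const].
    intros n. rewrite psum_at_0. unfold c. rewrite Hb1. simpl. f_equal. ring.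
  - intros z Hz.
    destruct (Hmain z Hz) as [F [H [G [Hfz [HD [_ [HHG [HF [HG HI]]]]]]]]].
    assert (HF0 : F <> RtoC 0).
    { intros ->. simpl in HF. lra. }
    split.
    + intros Hz0. rewrite Hfz. now apply Cmult_neq_0.
    + unfold starlike_quotient. destruct (Ceq_dec z (RtoC 0)) as [E|Hz0].
      * simpl. lra.
      * rewrite (is_C_derive_unique _ _ _ HD), Hfz, HHG.
        replace (z * (G + RtoC gamma * F) / (z * F))%C
          with (G / F + RtoC gamma)%C by (field; split; assumption).
        rewrite re_plus, re_RtoC. pose proof (Re_div_pos G F HG HF HI). lra.
Qed.

(** * The envelope attached to the two exponents *)

Definition log_weight (alpha beta p q x : R) : R :=
  p * ln (x + alpha) + q * ln (x + beta).

Definition power_envelope (alpha beta p q : R) (k : nat) : R :=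
  if (k <=? 1)%nat then 1 else exp (- log_weight alpha beta p q (INR k)).

Lemma power_envelope_ge_2 (alpha beta p q : R) (k : nat) :
  (2 <= k)%nat ->
  power_envelope alpha beta p q k = exp (- log_weight alpha beta p q (INR k)).
Proof.
  intros Hk. unfold power_envelope. now rewrite (proj2 (Nat.leb_gt k 1) ltac:(lia)).
Qed.

Lemma ln_le_log_weight (alpha beta p q x : R) :
  0 <= alpha -> 0 <= beta -> 0 <= p -> 0 <= q -> p + q = 1 ->
  0 < x -> ln x <= log_weight alpha beta p q x.
Proof.
  intros Halpha Hbeta Hp Hq Hpq Hx. unfold log_weight.
  pose proof (ln_le x (x + alpha) Hx ltac:(lra)).
  pose proof (ln_le x (x + beta) Hx ltac:(lra)).
  replace (ln x) with (p * ln x + q * ln x)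
    by (rewrite <- Rmult_plus_distr_r, Hpq; ring).
  apply Rplus_le_compat; now apply Rmult_le_compat_l.
Qed.

Lemma log_weight_incr (alpha beta p q x : R) :
  0 <= alpha -> 0 <= beta -> 0 <= p -> 0 <= q ->
  0 < x -> log_weight alpha beta p q x <= log_weight alpha beta p q (x + 1).
Proof.
  intros Halpha Hbeta Hp Hq Hx. unfold log_weight.
  apply Rplus_le_compat; apply Rmult_le_compat_l; try assumption; apply ln_le; lra.
Qed.

(** (x+1+s)/(x+s) <= (x+1)/x: a shift flattens the logarithm. *)
Lemma ln_shift_incr_le (x s : R) :
  0 < x -> 0 <= s -> ln (x + 1 + s) - ln (x + s) <= ln (x + 1) - ln x.
Proof.
  intros Hx Hs.
  enough (H : ln ((x + 1 + s) * x) <= ln ((x + 1) * (x + s))).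
  { rewrite !ln_mult in H by lra. lra. }
  apply ln_le; [apply Rmult_lt_0_compat; lra|nra].
Qed.

Lemma log_weight_incr_le (alpha beta p q x : R) :
  0 <= alpha -> 0 <= beta -> 0 <= p -> 0 <= q -> p + q = 1 -> 0 < x ->
  log_weight alpha beta p q (x + 1) - log_weight alpha beta p q x
  <= ln (x + 1) - ln x.
Proof.
  intros Halpha Hbeta Hp Hq Hpq Hx. unfold log_weight.
  pose proof (Rmult_le_compat_l p _ _ Hp (ln_shift_incr_le x alpha Hx Halpha)).
  pose proof (Rmult_le_compat_l q _ _ Hq (ln_shift_incr_le x beta Hx Hbeta)).
  replace (ln (x + 1) - ln x)
    with (p * (ln (x + 1) - ln x) + q * (ln (x + 1) - ln x))
    by (rewrite <- Rmult_plus_distr_r, Hpq; ring).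
  lra.
Qed.

Lemma exp_le_compat (x y : R) : x <= y -> exp x <= exp y.
Proof. intros [H| ->]; [left; now apply exp_increasing|lra]. Qed.

Lemma power_envelope_spec (alpha beta p q : R) :
  0 <= alpha -> 0 <= beta -> 0 <= p -> 0 <= q -> p + q = 1 ->
  envelope (power_envelope alpha beta p q).
Proof.
  intros Halpha Hbeta Hp Hq Hpq.
  assert (Hone : power_envelope alpha beta p q 1 = 1) by reflexivity.
  pose proof (fun x => ln_le_log_weight alpha beta p q x Halpha Hbeta Hp Hq Hpq) as Hln.
  split.
  - exact Hone.
  - intros k Hk. unfold power_envelope.
    destruct (k <=? 1)%nat; [lra|apply exp_pos].
  - intros k Hk. pose proof (lt_0_INR k ltac:(lia)) as H0.
    rewrite (power_envelope_ge_2 _ _ _ _ (S k)) by lia. rewrite S_INR.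
    destruct (le_lt_dec 2 k) as [H2|H2].
    + rewrite power_envelope_ge_2 by lia. apply exp_le_compat.
      pose proof (log_weight_incr _ _ _ _ _ Halpha Hbeta Hp Hq H0). lra.
    + replace k with 1%nat by lia. rewrite Hone. change (INR 1) with 1.
      apply Rle_trans with (exp 0); [apply exp_le_compat|rewrite exp_0; lra].
      pose proof (Hln (1 + 1) ltac:(lra)).
      pose proof (ln_le 1 (1 + 1) ltac:(lra) ltac:(lra)) as Hl2. rewrite ln_1 in Hl2. lra.
  - intros k Hk. pose proof (lt_0_INR k ltac:(lia)) as H0.
    destruct (le_lt_dec 2 k) as [H2|H2].
    + rewrite power_envelope_ge_2 by lia.
      rewrite <- (exp_ln (INR k)) at 1 by exact H0.
      rewrite <- exp_plus, <- exp_0. apply exp_le_compat.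
      pose proof (Hln _ H0). lra.
    + replace k with 1%nat by lia. rewrite Hone. simpl. lra.
  - intros k Hk. pose proof (lt_0_INR k ltac:(lia)) as H0.
    rewrite !power_envelope_ge_2 by lia. rewrite S_INR.
    rewrite <- (exp_ln (INR k)) at 1 by exact H0.
    rewrite <- (exp_ln (INR k + 1)) at 1 by lra.
    rewrite <- !exp_plus. apply exp_le_compat.
    pose proof (log_weight_incr_le _ _ _ _ _ Halpha Hbeta Hp Hq Hpq H0). lra.
Qed.

Lemma Rpower_weight_le_ratio (s p l y : R) :
  0 < y -> 0 <= s -> p <= l ->
  - l * ln (1 + 1 / (y + s)) <= - (p * (ln (y + 1 + s) - ln (y + s))).
Proof.
  intros Hy Hs Hpl.
  assert (E : ln (1 + 1 / (y + s)) = ln (y + 1 + s) - ln (y + s)).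
  { rewrite <- ln_div by lra. f_equal. field. lra. }
  rewrite E. pose proof (ln_le (y + s) (y + 1 + s) ltac:(lra) ltac:(lra)) as H.
  pose proof (Rmult_le_compat_r (ln (y + 1 + s) - ln (y + s)) p l
    ltac:(lra) Hpl). lra.
Qed.

(** Lowering the exponents from lambda, mu to p, q weakens the hypotheses, since
    all the bases are at least 1; this is how the case lambda + mu > 1 is reduced
    to exponents of sum 1. *)
Lemma dominated_of_ratio_bounds (alpha beta lambda mu p q : R) (d : nat -> R) :
  0 <= alpha -> 0 <= beta -> p <= lambda -> q <= mu ->
  (forall k, (1 <= k)%nat -> 0 <= d k) ->
  d 2%nat <= 1 / (Rpower (2 + alpha) lambda * Rpower (2 + beta) mu) * d 1%nat ->
  (forall k, (2 <= k)%nat ->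
     d (S k) <= Rpower (1 + 1 / (INR k + alpha)) (- lambda)
                * Rpower (1 + 1 / (INR k + beta)) (- mu) * d k) ->
  dominated (power_envelope alpha beta p q) d.
Proof.
  intros Halpha Hbeta Hpl Hqm Hpos H2 H3 k Hk. split; [now apply Hpos|].
  pose proof (Hpos k Hk) as Hdk. pose proof (lt_0_INR k ltac:(lia)) as H0.
  destruct (le_lt_dec 2 k) as [Hk2|Hk2].
  - rewrite !power_envelope_ge_2 by lia. rewrite S_INR.
    set (E := exp (- log_weight alpha beta p q (INR k))).
    apply Rle_trans with (Rpower (1 + 1 / (INR k + alpha)) (- lambda)
      * Rpower (1 + 1 / (INR k + beta)) (- mu) * d k * E).
    { apply Rmult_le_compat_r; [left; apply exp_pos|now apply H3]. }
    unfold Rpower, E. rewrite (Rmult_comm _ (d k)), Rmult_assoc, <- !exp_plus.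
    apply Rmult_le_compat_l; [assumption|]. apply exp_le_compat.
    pose proof (Rpower_weight_le_ratio alpha p lambda _ H0 Halpha Hpl).
    pose proof (Rpower_weight_le_ratio beta q mu _ H0 Hbeta Hqm).
    unfold log_weight. lra.
  - replace k with 1%nat in * by lia.
    rewrite (power_envelope_ge_2 _ _ _ _ 2) by lia.
    replace (power_envelope alpha beta p q 1) with 1 by reflexivity.
    rewrite Rmult_1_r. eapply Rle_trans; [exact H2|].
    rewrite Rmult_comm. apply Rmult_le_compat_l; [assumption|].
    unfold Rpower. rewrite <- exp_plus, Rdiv_1_l, <- exp_Ropp.
    apply exp_le_compat. unfold log_weight. change (INR 2) with 2.
    pose proof (ln_le 1 (2 + alpha) ltac:(lra) ltac:(lra)) as Ha.
    pose proof (ln_le 1 (2 + beta) ltac:(lra) ltac:(lra)) as Hb.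
    rewrite ln_1 in Ha, Hb.
    pose proof (Rmult_le_compat_r _ _ _ Ha Hpl).
    pose proof (Rmult_le_compat_r _ _ _ Hb Hqm). lra.
Qed.

(** The truncated coefficients are a_k times an indicator, a nonincreasing weight,
    so the polynomials are themselves sums of dominated power series. *)
Lemma starlike_truncations_and_limit (e a : nat -> R) (gamma : R) :
  envelope e -> 0 <= gamma < 1 -> a 1%nat = 1 ->
  (2 - gamma) * a 2%nat <= 1 - gamma ->
  dominated e (fun k => (INR k + 1 - gamma) * a (S k)) ->
  (forall n, starlike gamma (fpoly a n)) /\
  (exists f : C -> C,
     (forall z, unit_disk z ->
        filterlim (fun n => fpoly a n z) eventually (locally (f z))) /\
     starlike gamma f).
Proof.
  intros He Hg Ha1 Ha2 Hd. split.
  - intros n. set (M := Nat.max n 1).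
    set (b := fun k => a k * (if (k <=? M)%nat then 1 else 0)).
    assert (Hb : forall k, (k <= M)%nat -> b k = a k).
    { intros k Hk. unfold b. rewrite (proj2 (Nat.leb_le k M) Hk). ring. }
    assert (Hb0 : forall k, (M < k)%nat -> b k = 0).
    { intros k Hk. unfold b. rewrite (proj2 (Nat.leb_gt k M) Hk). ring. }
    apply starlike_of_dominated with e b; try assumption.
    + rewrite Hb by lia. exact Ha1.
    + unfold b. destruct (2 <=? M)%nat; nra.
    + apply dominated_ext with
        (fun k => (INR k + 1 - gamma) * a (S k) * (if (S k <=? M)%nat then 1 else 0)).
      { intros k. unfold b. ring. }
      apply dominated_mul; [assumption|assumption|]. intros k Hk.
      destruct (Nat.leb_spec (S (S k)) M), (Nat.leb_spec (S k) M); try lra; lia.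
    + intros z _. apply Clim_filterlim.
      apply filterlim_ext_loc with (fun _ => fpoly a n z); [|apply filterlim_const].
      exists M. intros m Hm. induction Hm as [|m Hm IH].
      * unfold fpoly. f_equal.
        destruct n as [|n]; [unfold M; now rewrite !sum_n_m_zero by lia|].
        replace M with (S n) by (unfold M; lia).
        apply sum_n_m_ext_loc. intros k Hk. rewrite Hb by (unfold M; lia). reflexivity.
      * rewrite IH. unfold fpoly. rewrite (sum_n_Sm _ 2 m) by (unfold M in Hm; lia).
        change plus with Cplus. rewrite (Hb0 (S m)) by lia. ring.
  - set (c := fun k => a (S k)).
    assert (Hc : dominated e c) by (apply dominated_coefficients with gamma; assumption).
    assert (Hcb : forall k, Rabs (c k) <= 1).
    { now apply dominated_bounded with e gamma. }
    set (f := fun z : C => (real (Lim_seq (fun n => Re (fpoly a n z))),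
                            real (Lim_seq (fun n => Im (fpoly a n z)))) : C).
    assert (Hf : forall z, unit_disk z -> Clim (fun n => fpoly a n z) (f z)).
    { intros z Hz. destruct (Clim_psum_of_bounded c z Hcb Hz) as [F HF].
      assert (HL : Clim (fun n => fpoly a n z) (z * F)%C).
      { apply Clim_incr_1. apply Clim_ext with (fun n => z * psum c n z)%C.
        - intros n. symmetry. now apply fpoly_S.
        - now apply Clim_scal. }
      replace (f z) with (z * F)%C; [exact HL|].
      destruct HL as [HLr HLi]. unfold f.
      rewrite (is_lim_seq_unique _ _ HLr), (is_lim_seq_unique _ _ HLi).
      now destruct (z * F)%C. }
    exists f. split.
    + intros z Hz. now apply Clim_filterlim, Hf.
    + now apply starlike_of_dominated with e a.
Qed.

Theorem theorem2p1 (alpha beta lambda mu gamma : R) (a : nat -> R)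
  (Halpha : 0 <= alpha) (Hbeta : 0 <= beta)
  (Hlambda : 0 <= lambda) (Hmu : 0 <= mu) (Hlm : lambda + mu >= 1)
  (Hgamma : 0 <= gamma < 1)
  (Hpos : forall k : nat, (1 <= k)%nat -> 0 < a k)
  (Ha1 : a 1%nat = 1)
  (H1 : (2 - gamma) * a 2%nat <= (1 - gamma) * a 1%nat)
  (H2 : (3 - gamma) * a 3%nat <=
        1 / (Rpower (2 + alpha) lambda * Rpower (2 + beta) mu)
        * ((2 - gamma) * a 2%nat))
  (H3 : forall k : nat, (2 <= k)%nat ->
        (INR k + 2 - gamma) * a (k + 2)%nat <=
        Rpower (1 + 1 / (INR k + alpha)) (- lambda)
        * Rpower (1 + 1 / (INR k + beta)) (- mu)
        * ((INR k + 1 - gamma) * a (k + 1)%nat)) :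
  (forall n : nat, starlike gamma (fpoly a n)) /\
  (exists f : C -> C,
     (forall z : C, unit_disk z ->
        filterlim (fun n : nat => fpoly a n z) eventually (locally (f z))) /\
     starlike gamma f).
Proof.
  assert (Hs : 0 < / (lambda + mu) <= 1).
  { split; [apply Rinv_0_lt_compat; lra|].
    rewrite <- Rinv_1. apply Rinv_le_contravar; lra. }
  set (p := lambda * / (lambda + mu)). set (q := mu * / (lambda + mu)).
  assert (Hp : 0 <= p <= lambda) by (unfold p; nra).
  assert (Hq : 0 <= q <= mu) by (unfold q; nra).
  assert (Hpq : p + q = 1) by (unfold p, q; field; lra).
  apply starlike_truncations_and_limit with (power_envelope alpha beta p q).
  - apply power_envelope_spec; lra.
  - assumption.
  - assumption.
  - rewrite Ha1 in H1. lra.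
  - apply dominated_of_ratio_bounds with lambda mu; try lra.
    + intros k Hk. apply Rmult_le_pos; [pose proof (pos_INR k); lra|].
      left. apply Hpos. lia.
    + replace (INR 2 + 1 - gamma) with (3 - gamma) by (simpl; ring).
      replace (INR 1 + 1 - gamma) with (2 - gamma) by (simpl; ring). exact H2.
    + intros k Hk. specialize (H3 k Hk).
      rewrite !Nat.add_succ_r, Nat.add_0_r in H3. rewrite S_INR.
      replace (INR k + 1 + 1 - gamma) with (INR k + 2 - gamma) by ring. exact H3.
Qed.
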